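(* Let $\lambda: R\to S$ be a ring epimorphism and $M$ an $S$-$S$-bimodule such that $\mathrm{Tor}^R_i(M,S)=0$ for all $i\geq 1$. If $_RS$ has a finite projective resolution by finitely generated projective $R$-modules, then (a) $\mathrm{fin.dim}(S\ltimes M)\leq \mathrm{fin.dim}(S)+\mathrm{fin.dim}(R\ltimes M)+1$. (b) $\mathrm{fin.dim}(S)\leq \mathrm{fin.dim}(R)+\mathrm{fin.dim}(S\ltimes M)$.
   Context: Rings are associative with identity. $\mathrm{fin.dim}(A)$ of a ring $A$ is the supremum of the projective dimensions of those left $A$-modules that have a finite projective resolution by finitely generated projective modules. Inequalities are in $\mathbb{N}\cup\{\infty\}$. A ring epimorphism is an epimorphism in the category of rings. For a ring $A$ and an $A$-$A$-bimodule $M$, the trivial extension $A\ltimes M$ is the ring with abelian group $A\oplus M$ and multiplication $(a,m)(a',m')=(aa',am'+ma')$. $S$ and $M$ are regarded as $R$-$R$-bimodules via $\lambda$. *)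

(* Defs.v *)
From HB Require Import structures.
From mathcomp Require Import all_boot all_order all_algebra.
From mathcomp Require Import boolp freeg.

Set Implicit Arguments.
Unset Strict Implicit.
Unset Printing Implicit Defensive.

Import GRing.Theory.
Local Open Scope ring_scope.

(* Rings are pzRingType: associative, with identity, the zero ring allowed.
   Left A-modules are lmodType A; right A-modules are lmodType A^c. *)

Variant enat := Fin of nat | Infty.

Definition enat_le (x y : enat) : bool :=
  match x, y with
  | _, Infty => true
  | Infty, Fin _ => false
  | Fin m, Fin n => (m <= n)%N
  end.

Definition enat_add (x y : enat) : enat :=
  match x, y with
  | Fin m, Fin n => Fin (m + n)
  | _, _ => Infty
  end.

Declare Scope enat_scope.
Delimit Scope enat_scope with enat.
Bind Scope enat_scope with enat.
Notation "x <= y" := (enat_le x y) : enat_scope.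
Notation "x + y" := (enat_add x y) : enat_scope.

Definition enat_least (P : nat -> Prop) : enat :=
  match pselect (exists n, `[< P n >]) with
  | left exP => Fin (ex_minn exP)
  | right _ => Infty
  end.

(* The least upper bound; the supremum of the empty family is 0. *)
Definition enat_sup (E : enat -> Prop) : enat :=
  enat_least (fun n => forall e, E e -> (e <= Fin n)%enat).

Definition surj (U V : Type) (f : U -> V) : Prop := forall v, exists u, f u = v.

Definition exact_at (U V W : zmodType) (f : U -> V) (g : V -> W) : Prop :=
  forall v, g v = 0 <-> exists u, f u = v.

Definition projective (A : pzRingType) (P : lmodType A) : Prop :=
  forall (X Y : lmodType A) (g : {linear X -> Y}) (f : {linear P -> Y}),
    surj g -> exists h : {linear P -> X}, forall p, g (h p) = f p.

Definition finitely_generated (A : pzRingType) (X : lmodType A) : Prop :=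
  exists (n : nat) (g : 'I_n -> X),
    forall x, exists c : 'I_n -> A, x = \sum_(i < n) c i *: g i.

Record proj_resolution (A : pzRingType) (X : lmodType A) := ProjResolution {
  res_obj :> nat -> lmodType A;
  res_d : forall i, {linear res_obj i.+1 -> res_obj i};
  res_aug : {linear res_obj 0 -> X};
  res_projective : forall i, projective (res_obj i);
  res_aug_surj : surj res_aug;
  res_exact0 : exact_at (res_d 0) res_aug;
  res_exactS : forall i, exact_at (res_d i.+1) (res_d i)
}.

Definition res_length_le (A : pzRingType) (X : lmodType A)
    (P : proj_resolution X) (n : nat) : Prop :=
  forall i, (n < i)%N -> forall p : P i, p = 0.

Definition proj_dim (A : pzRingType) (X : lmodType A) : enat :=
  enat_least (fun n => exists P : proj_resolution X, res_length_le P n).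

Definition has_finite_fg_proj_resolution
    (A : pzRingType) (X : lmodType A) : Prop :=
  exists (P : proj_resolution X) (n : nat),
    res_length_le P n /\ forall i, finitely_generated (P i).

Definition findim (A : pzRingType) : enat :=
  enat_sup (fun e => exists X : lmodType A,
    has_finite_fg_proj_resolution X /\ e = proj_dim X).

Definition ring_epi (R S : pzRingType) (f : {rmorphism R -> S}) : Prop :=
  forall (T : pzRingType) (g h : {rmorphism S -> T}),
    (forall r, g (f r) = h (f r)) -> forall s, g s = h s.

Record bimodType (A B : pzRingType) := Bimodule {
  bimod_left :> lmodType A;
  rscale : bimod_left -> B -> bimod_left;
  rscale1 : forall m, rscale m 1 = m;
  rscaleA : forall m b c, rscale (rscale m b) c = rscale m (b * c);
  rscaleDl : forall m m' b, rscale (m + m') b = rscale m b + rscale m' b;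
  rscaleDr : forall m b c, rscale m (b + c) = rscale m b + rscale m c;
  rscaleAl : forall a m b, a *: rscale m b = rscale (a *: m) b
}.

Definition bimod_right (A B : pzRingType) (M : bimodType A B) : Type := M.

Section BimodRight.
Variables (A B : pzRingType) (M : bimodType A B).

HB.instance Definition _ := GRing.Zmodule.copy (bimod_right M) M.

Let scale (b : B^c) (m : bimod_right M) : bimod_right M := rscale (m : M) b.

Fact bimod_right_scaleA b c m : scale b (scale c m) = scale (b * c) m.
Proof. exact: rscaleA. Qed.

Fact bimod_right_scale1 : left_id 1 scale.
Proof. exact: rscale1. Qed.

Fact bimod_right_scaleDr : right_distributive scale +%R.
Proof. by move=> b m m'; exact: rscaleDl. Qed.

Fact bimod_right_scaleDl m : {morph scale^~ m : b c / b + c}.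
Proof. by move=> b c; exact: rscaleDr. Qed.

HB.instance Definition _ := GRing.Zmodule_isLmodule.Build B^c (bimod_right M)
  bimod_right_scaleA bimod_right_scale1 bimod_right_scaleDr bimod_right_scaleDl.

End BimodRight.

Definition restr (R S : pzRingType) (f : {rmorphism R -> S})
  (V : lmodType S) : Type := V.

Section Restr.
Variables (R S : pzRingType) (f : {rmorphism R -> S}) (V : lmodType S).

HB.instance Definition _ := GRing.Zmodule.copy (restr f V) V.

Let scale (r : R) (v : restr f V) : restr f V := f r *: (v : V).

Fact restr_scaleA r s v : scale r (scale s v) = scale (r * s) v.
Proof. by rewrite /scale scalerA rmorphM. Qed.

Fact restr_scale1 : left_id 1 scale.
Proof. by move=> v; rewrite /scale rmorph1 scale1r. Qed.

Fact restr_scaleDr : right_distributive scale +%R.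
Proof. by move=> r v w; rewrite /scale scalerDr. Qed.

Fact restr_scaleDl v : {morph scale^~ v : r s / r + s}.
Proof. by move=> r s; rewrite /scale rmorphD scalerDl. Qed.

HB.instance Definition _ := GRing.Zmodule_isLmodule.Build R (restr f V)
  restr_scaleA restr_scale1 restr_scaleDr restr_scaleDl.

End Restr.

Section RestrBimod.
Variables (R S : pzRingType) (f : {rmorphism R -> S}) (M : bimodType S S).

Let rsc (m : restr f M) (r : R) : restr f M := rscale (m : M) (f r).

Fact restr_rscale1 m : rsc m 1 = m.
Proof. by rewrite /rsc rmorph1 rscale1. Qed.

Fact restr_rscaleA m r s : rsc (rsc m r) s = rsc m (r * s).
Proof. by rewrite /rsc rscaleA rmorphM. Qed.

Fact restr_rscaleDl m m' r : rsc (m + m') r = rsc m r + rsc m' r.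
Proof. exact: rscaleDl. Qed.

Fact restr_rscaleDr m r s : rsc m (r + s) = rsc m r + rsc m s.
Proof. by rewrite /rsc rmorphD rscaleDr. Qed.

Fact restr_rscaleAl r m s : r *: rsc m s = rsc (r *: m) s.
Proof. exact: rscaleAl. Qed.

Definition restr_bimod : bimodType R R :=
  Bimodule restr_rscale1 restr_rscaleA restr_rscaleDl restr_rscaleDr
    restr_rscaleAl.

End RestrBimod.

Definition trivext (A : pzRingType) (M : bimodType A A) : Type := (A * M)%type.

Section Trivext.
Variables (A : pzRingType) (M : bimodType A A).

HB.instance Definition _ := GRing.Zmodule.copy (trivext M) (A * M)%type.

Let one : trivext M := (1, 0).
Let mul (x y : trivext M) : trivext M :=
  (x.1 * y.1, x.1 *: y.2 + rscale x.2 y.1).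

Let rscale0l (a : A) : rscale (0 : M) a = 0.
Proof. by apply: (addrI (rscale 0 a)); rewrite -rscaleDl !addr0. Qed.

Let rscale0r (m : M) : rscale m 0 = 0.
Proof. by apply: (addrI (rscale m 0)); rewrite -rscaleDr !addr0. Qed.

Fact trivext_mulA : associative mul.
Proof.
move=> x y z; congr pair; rewrite /= ?mulrA //.
by rewrite scalerDr rscaleDl scalerA rscaleAl rscaleA addrA.
Qed.

Fact trivext_mul1l : left_id one mul.
Proof. by case=> a m; rewrite /mul /= mul1r scale1r rscale0l addr0. Qed.

Fact trivext_mul1r : right_id one mul.
Proof. by case=> a m; rewrite /mul /= mulr1 scaler0 rscale1 add0r. Qed.

Fact trivext_mulDl : left_distributive mul +%R.
Proof.
move=> x y z; congr pair; rewrite /= ?mulrDl //.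
by rewrite scalerDl rscaleDl addrACA.
Qed.

Fact trivext_mulDr : right_distributive mul +%R.
Proof.
move=> x y z; congr pair; rewrite /= ?mulrDr //.
by rewrite scalerDr rscaleDr addrACA.
Qed.

HB.instance Definition _ := GRing.Zmodule_isPzRing.Build (trivext M)
  trivext_mulA trivext_mul1l trivext_mul1r trivext_mulDl trivext_mulDr.

End Trivext.

Section Tensor.
Variables (R : pzRingType) (M : lmodType R^c) (X : lmodType R).

Local Notation free := {freeg (M * X)%type / int}.

Definition tens_gen (m : M) (x : X) : free := << (m, x) >>.

(* The subgroup generated by the relations of the tensor product; the scalar
   r : R^c acts on M from the right. *)
Inductive tens_rel : free -> Prop :=
| tens_rel0 : tens_rel 0
| tens_relB u v : tens_rel u -> tens_rel v -> tens_rel (u - v)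
| tens_relDl m m' x :
    tens_rel (tens_gen (m + m') x - (tens_gen m x + tens_gen m' x))
| tens_relDr m x x' :
    tens_rel (tens_gen m (x + x') - (tens_gen m x + tens_gen m x'))
| tens_relZ (r : R) m x :
    tens_rel (tens_gen ((r : R^c) *: m) x - tens_gen m (r *: x)).

Definition tens_relb (u : free) : bool := `[< tens_rel u >].

Fact tens_rel_zmod_closed : zmod_closed tens_relb.
Proof.
split; first exact/asboolP/tens_rel0.
by move=> u v /asboolP ru /asboolP rv; exact/asboolP/tens_relB.
Qed.

HB.instance Definition _ :=
  GRing.isZmodClosed.Build free tens_relb tens_rel_zmod_closed.

Definition tens : zmodType := Quotient.quot (GRing.ZmodClosed.clone free tens_relb _).

Definition tens_pure (m : M) (x : X) : tens := \pi_tens%qT (tens_gen m x).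

Fact tens_eq (u v : free) :
  tens_rel (u - v) <-> \pi_tens%qT u = \pi_tens%qT v.
Proof.
split=> [uv|/eqP]; first by apply/eqP; rewrite -Quotient.idealrBE; apply/asboolP.
by rewrite -Quotient.idealrBE => /asboolP.
Qed.

Fact tens_pureDl (m m' : M) (x : X) :
  tens_pure (m + m') x = tens_pure m x + tens_pure m' x.
Proof. by rewrite -[RHS]raddfD; apply/tens_eq/tens_relDl. Qed.

Fact tens_pureDr (m : M) (x x' : X) :
  tens_pure m (x + x') = tens_pure m x + tens_pure m x'.
Proof. by rewrite -[RHS]raddfD; apply/tens_eq/tens_relDr. Qed.

Fact tens_pureZ (r : R) (m : M) (x : X) :
  tens_pure ((r : R^c) *: m) x = tens_pure m (r *: x).
Proof. exact/tens_eq/tens_relZ. Qed.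

End Tensor.

(* The map sending m (x) x to m (x) f x, extended along a representative in the
   free abelian group; see tens_map_pure and tens_mapD. *)
Definition tens_map (R : pzRingType) (M : lmodType R^c) (X Y : lmodType R)
    (f : {linear X -> Y}) (t : tens M X) : tens M Y :=
  fglift (fun mx : M * X => tens_pure mx.1 (f mx.2) : zmodule (tens M Y)) (repr t).

Section TensMap.
Variables (R : pzRingType) (M : lmodType R^c) (X Y : lmodType R).
Variable f : {linear X -> Y}.

Let h (mx : M * X) : zmodule (tens M Y) := tens_pure mx.1 (f mx.2).
Let hB u v : fglift h (u - v) = fglift h u - fglift h v.
Proof. exact: lift_is_additive. Qed.
Let hD u v : fglift h (u + v) = fglift h u + fglift h v.
Proof. by rewrite -[v in LHS]opprK -[- v]sub0r !hB -[0 in X in _ - X](subrr 0) hB subrr sub0r opprK. Qed.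
Let hg m x : fglift h (tens_gen m x) = tens_pure m (f x).
Proof. by rewrite /tens_gen liftU scale1r. Qed.

Fact tens_map_rel u : tens_rel (M := M) (X := X) u -> fglift h u = 0.
Proof.
elim=> {u}.
- by rewrite -[0 in LHS](subrr 0) hB subrr.
- by move=> u v _ hu _ hv; rewrite hB hu hv subrr.
- by move=> m m' x; rewrite hB hD !hg tens_pureDl; exact: subrr.
- by move=> m x x'; rewrite hB hD !hg raddfD tens_pureDr; exact: subrr.
- by move=> r m x; rewrite hB !hg linearZ tens_pureZ; exact: subrr.
Qed.

Fact tens_map_pi u : tens_map f (\pi_(tens M X)%qT u) = fglift h u.
Proof.
apply/eqP; rewrite -subr_eq0; apply/eqP.
rewrite -[LHS]hB; apply: tens_map_rel; apply/tens_eq; exact: reprK.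
Qed.

Fact tens_map_pure (m : M) x : tens_map f (tens_pure m x) = tens_pure m (f x).
Proof. by rewrite tens_map_pi hg. Qed.

Fact tens_mapD (s t : tens M X) : tens_map f (s + t) = tens_map f s + tens_map f t.
Proof.
elim/quotW: s => u; elim/quotW: t => v.
by rewrite -[X in tens_map f X]raddfD !tens_map_pi hD.
Qed.
End TensMap.

(* Tor_i^R(M, X) is the i-th homology of the complex M (x) P, for any projective
   resolution P of X; the choice of P is immaterial. *)
Definition Tor_vanishes (R : pzRingType) (M : lmodType R^c) (X : lmodType R)
    (i : nat) : Prop :=
  forall P : proj_resolution X,
    match i with
    | 0 => surj (tens_map (M := M) (res_d P 0))
    | j.+1 => exact_at (tens_map (M := M) (res_d P j.+1))
                       (tens_map (M := M) (res_d P j))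
    end.

(* Main.v *)
Require Import Defs.
From HB Require Import structures.
From mathcomp Require Import all_boot all_order all_algebra.
From mathcomp Require Import boolp freeg.

Set Implicit Arguments.
Unset Strict Implicit.
Unset Printing Implicit Defensive.

Import GRing.Theory.
Local Open Scope ring_scope.

(** Write [T = S |x M] and [T' = R |x M] for the trivial extensions; a module is
    perfect when it has a finite resolution by finitely generated projectives.

    Two facts about the ring epimorphism drive the proof. First, [s (x) 1] and
    [1 (x) s] agree in [S (x)_R S], so [M (x)_R V] is [M (x)_S V] for every
    [S]-module [V], and in particular [M (x)_R S] is [M]. Secondly, together with
    the vanishing of [Tor^R(M, S)], tensoring an [R]-resolution of [S] with [T']
    gives a resolution of [T]; so [T] is perfect over [T'], and [R (x)_T' T] is
    [S], with no higher [Tor]. Hence perfect modules over [S] or over [T]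
    restrict to perfect modules over [R] or over [T'] ([restr_fgres]), and a
    right exact functor [G] over the smaller ring can be derived through
    resolutions over the larger one, whose terms are acyclic. If the smaller ring
    has finitistic dimension [n], then [G P] is exact in degrees greater than [n]
    for each finite resolution [P] over the larger ring ([exact_above_findim]).

    For the second inequality, let [P] be a finite resolution of an [S]-module
    and [r] the finitistic dimension of [R]. With [G = M (x)_R -], the complex
    [T (x)_S P = P + M (x)_S P] is exact in degrees greater than [r]. From degree
    [r] on it resolves a perfect [T]-module, so it is contractible above degree
    [r + e], where [e] is the finitistic dimension of [T] ([findim_contraction]).
    As [P] is a direct summand of it, the projective dimension of the module is
    at most [r + e] ([pd_le_split]).

    For the first one, let [P] be a finite resolution of a [T]-module and [t]
    the finitistic dimension of [T']. With [G] the reduction modulo [M], which is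
    [R (x)_T' -] over [T'] and [S (x)_T -] over [T], the complex [P / M P] of
    projective [S]-modules is exact in degrees greater than [t], hence contractible
    above degree [s + t], where [s] is the finitistic dimension of [S]. Since [M]
    is an ideal of square zero in [T], such a contraction lifts to [P]
    ([lift_contraction]). This gives the bound [s + t]. *)

(** * Linear maps, submodules and quotients *)

Section MakeLinear.
Variables (A : pzRingType) (U V : lmodType A) (f : U -> V) (fP : linear f).

(** A copy of [f] carrying the linear structure, so that [mklin] turns a function
    and a proof of its linearity into a bundled linear map. *)
Definition lin_fun of linear f := f.
HB.instance Definition _ := GRing.isLinear.Build A U V _ (lin_fun fP) fP.
Definition mklin : {linear U -> V} := lin_fun fP.

Lemma mklinE x : mklin x = f x. Proof. by []. Qed.

End MakeLinear.

Lemma linear_of_addZ (A : pzRingType) (U V : lmodType A) (f : U -> V) :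
  (forall x y, f (x + y) = f x + f y) -> (forall a x, f (a *: x) = a *: f x) ->
  linear f.
Proof. by move=> fD fZ a x y; rewrite fD fZ. Qed.

Section Basic.
Variable A : pzRingType.
Implicit Types U V W X Y Z P : lmodType A.

Lemma lin_comp_subproof U V W (g : {linear V -> W}) (f : {linear U -> V}) :
  linear (fun x => g (f x)).
Proof. by move=> a x y; rewrite !linearP. Qed.
Definition lin_comp U V W (g : {linear V -> W}) (f : {linear U -> V}) :=
  mklin (lin_comp_subproof g f).

Lemma lin_id_subproof U : linear (fun x : U => x). Proof. by []. Qed.
Definition lin_id U := mklin (@lin_id_subproof U).

Lemma lin_zero_subproof U V : linear (fun _ : U => 0 : V).
Proof. by move=> a x y; rewrite scaler0 addr0. Qed.
Definition lin_zero U V := mklin (@lin_zero_subproof U V).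

Lemma lin_add_subproof U V (f g : {linear U -> V}) : linear (fun x => f x + g x).
Proof. by move=> a x y; rewrite !linearP scalerDr addrACA. Qed.
Definition lin_add U V (f g : {linear U -> V}) := mklin (lin_add_subproof f g).

Lemma lin_opp_subproof U V (f : {linear U -> V}) : linear (fun x => - f x).
Proof. by move=> a x y; rewrite linearP opprD scalerN. Qed.
Definition lin_opp U V (f : {linear U -> V}) := mklin (lin_opp_subproof f).

Definition lin_sub U V (f g : {linear U -> V}) := lin_add f (lin_opp g).

Lemma lin_fst_subproof U V : linear (fun x : (U * V)%type => x.1). Proof. by []. Qed.
Definition lin_fst U V := mklin (@lin_fst_subproof U V).
Lemma lin_snd_subproof U V : linear (fun x : (U * V)%type => x.2). Proof. by []. Qed.
Definition lin_snd U V := mklin (@lin_snd_subproof U V).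

Lemma lin_pair_subproof U V W (f : {linear U -> V}) (g : {linear U -> W}) :
  linear (fun x => (f x, g x)).
Proof. by move=> a x y; rewrite !linearP. Qed.
Definition lin_pair U V W (f : {linear U -> V}) (g : {linear U -> W}) :
  {linear U -> (V * W)%type} := mklin (lin_pair_subproof f g).

Definition lin_case U V W (f : {linear U -> W}) (g : {linear V -> W}) :
    {linear (U * V)%type -> W} :=
  lin_add (lin_comp f (lin_fst U V)) (lin_comp g (lin_snd U V)).

Definition lin_inl U V : {linear U -> (U * V)%type} := lin_pair (lin_id U) (lin_zero U V).
Definition lin_inr U V : {linear V -> (U * V)%type} := lin_pair (lin_zero V U) (lin_id V).

Lemma lin_compE U V W (g : {linear V -> W}) (f : {linear U -> V}) x :
  lin_comp g f x = g (f x). Proof. by []. Qed.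
Lemma lin_idE U (x : U) : lin_id U x = x. Proof. by []. Qed.
Lemma lin_zeroE U V (x : U) : lin_zero U V x = 0. Proof. by []. Qed.
Lemma lin_addE U V (f g : {linear U -> V}) x : lin_add f g x = f x + g x.
Proof. by []. Qed.
Lemma lin_oppE U V (f : {linear U -> V}) x : lin_opp f x = - f x.
Proof. by []. Qed.
Lemma lin_subE U V (f g : {linear U -> V}) x : lin_sub f g x = f x - g x.
Proof. by []. Qed.
Lemma lin_fstE U V (x : U * V) : lin_fst U V x = x.1. Proof. by []. Qed.
Lemma lin_sndE U V (x : U * V) : lin_snd U V x = x.2. Proof. by []. Qed.
Lemma lin_pairE U V W (f : {linear U -> V}) (g : {linear U -> W}) x :
  lin_pair f g x = (f x, g x). Proof. by []. Qed.
Lemma lin_caseE U V W (f : {linear U -> W}) (g : {linear V -> W}) x :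
  lin_case f g x = f x.1 + g x.2. Proof. by []. Qed.
Lemma lin_inlE U V x : lin_inl U V x = (x, 0). Proof. by []. Qed.
Lemma lin_inrE U V x : lin_inr U V x = (0, x). Proof. by []. Qed.
Definition linE := (lin_compE, lin_idE, lin_zeroE, lin_addE, lin_oppE, lin_subE,
  lin_fstE, lin_sndE, lin_pairE, lin_caseE, lin_inlE, lin_inrE).

Lemma lin_factor U V W (p : {linear U -> V}) (f : {linear U -> W}) :
    surj p -> (forall u, p u = 0 -> f u = 0) ->
  exists g : {linear V -> W}, forall u, g (p u) = f u.
Proof.
move=> p_surj kerf; pose s v := sval (cid (p_surj v)).
have sK v : p (s v) = v by rewrite /s; case: cid.
have fs u : f (s (p u)) = f u.
  by apply/eqP; rewrite -subr_eq0 -linearB; apply/eqP/kerf; rewrite linearB /= sK subrr.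
have lin_fs : linear (fun v => f (s v)).
  by move=> a x y; rewrite -(sK x) -(sK y) -linearP !fs linearP.
by exists (mklin lin_fs) => u; rewrite mklinE fs.
Qed.

Record submod (V : lmodType A) := Submod {
  submod_pred :> V -> Prop;
  submod0 : submod_pred 0;
  submodD : forall x y, submod_pred x -> submod_pred y -> submod_pred (x + y);
  submodZ : forall a x, submod_pred x -> submod_pred (a *: x)
}.

Lemma submodB V (W : submod V) x y : W x -> W y -> W (x - y).
Proof. by move=> Wx Wy; rewrite -scaleN1r; apply/submodD/submodZ. Qed.

Lemma ker_submodD U V (f : {linear U -> V}) x y :
  f x = 0 -> f y = 0 -> f (x + y) = 0.
Proof. by move=> fx fy; rewrite linearD fx fy addr0. Qed.
Lemma ker_submodZ U V (f : {linear U -> V}) a x : f x = 0 -> f (a *: x) = 0.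
Proof. by move=> fx; rewrite linearZ /= fx scaler0. Qed.
Definition ker_submod U V (f : {linear U -> V}) : submod U :=
  Submod (linear0 f) (@ker_submodD U V f) (@ker_submodZ U V f).
Lemma ker_submodE U V (f : {linear U -> V}) x : ker_submod f x <-> f x = 0.
Proof. by []. Qed.

Lemma im_submod0 U V (f : {linear U -> V}) : exists u, f u = 0.
Proof. by exists 0; rewrite linear0. Qed.
Lemma im_submodD U V (f : {linear U -> V}) x y :
  (exists u, f u = x) -> (exists u, f u = y) -> exists u, f u = x + y.
Proof. by move=> [u <-] [v <-]; exists (u + v); rewrite linearD. Qed.
Lemma im_submodZ U V (f : {linear U -> V}) a x :
  (exists u, f u = x) -> exists u, f u = a *: x.
Proof. by move=> [u <-]; exists (a *: u); rewrite linearZ. Qed.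
Definition im_submod U V (f : {linear U -> V}) : submod V :=
  Submod (im_submod0 f) (@im_submodD U V f) (@im_submodZ U V f).
Lemma im_submodE U V (f : {linear U -> V}) v : im_submod f v <-> exists u, f u = v.
Proof. by []. Qed.

Section Sub.
Variables (V : lmodType A) (W : submod V).

Definition submodb (v : V) : bool := `[< W v >].
Fact submodb_closed : submod_closed submodb.
Proof.
split=> [|a x y /asboolP Wx /asboolP Wy]; apply/asboolP; first exact: submod0.
exact/submodD/Wy/submodZ.
Qed.
HB.instance Definition _ :=
  GRing.isSubmodClosed.Build A V submodb (GRing.submod_closed_semi submodb_closed).

Definition subtype := {v : V | submodb v}.
HB.instance Definition _ := SubChoice.on subtype.
HB.instance Definition _ := [SubChoice_isSubLmodule of subtype by <:].

Lemma sub_incl_subproof : linear (fun x : subtype => val x). Proof. by []. Qed.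
Definition sub_incl : {linear subtype -> V} := mklin sub_incl_subproof.

Lemma sub_incl_inj : injective sub_incl. Proof. exact: val_inj. Qed.
Lemma sub_inclP (x : subtype) : W (sub_incl x). Proof. exact/asboolP/(valP x). Qed.
Lemma sub_incl_ex v : W v <-> exists x, sub_incl x = v.
Proof.
split=> [/asboolP Wv|[x <-]]; last exact: sub_inclP.
by exists (Sub v Wv).
Qed.

Lemma corestr_subproof U (f : {linear U -> V}) (Wf : forall u, W (f u)) :
  linear (fun u => Sub (f u) (asboolT (Wf u)) : subtype).
Proof. by move=> a x y; apply: val_inj; rewrite /= linearP. Qed.
Definition corestr U (f : {linear U -> V}) (Wf : forall u, W (f u)) :=
  mklin (corestr_subproof Wf).
Lemma corestrE U (f : {linear U -> V}) (Wf : forall u, W (f u)) u :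
  sub_incl (corestr Wf u) = f u.
Proof. by []. Qed.

Definition quotmod := Quotient.quot (GRing.ZmodClosed.clone V submodb _).
HB.instance Definition _ := GRing.Zmodule.on quotmod.

Definition quot_pi (v : V) : quotmod := \pi_quotmod%qT v.

Lemma quot_pi_eq u v : quot_pi u = quot_pi v <-> W (u - v).
Proof.
split=> [/eqP|Wuv]; first by rewrite -Quotient.idealrBE => /asboolP.
by apply/eqP; rewrite -Quotient.idealrBE; apply/asboolP.
Qed.
Lemma quot_piD : {morph quot_pi : u v / u + v}.
Proof. by move=> u v; rewrite /quot_pi raddfD. Qed.

Definition quot_scale a (x : quotmod) : quotmod := quot_pi (a *: repr x).
Lemma quot_scale_pi a v : quot_scale a (quot_pi v) = quot_pi (a *: v).
Proof.
apply/quot_pi_eq; rewrite -scalerBr; apply/submodZ/quot_pi_eq; exact: reprK.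
Qed.
Lemma quot_pi_surj : surj quot_pi.
Proof. by move=> x; exists (repr x); exact: reprK. Qed.

Fact quot_scaleA a b x : quot_scale a (quot_scale b x) = quot_scale (a * b) x.
Proof. by case: (quot_pi_surj x) => v <-; rewrite !quot_scale_pi scalerA. Qed.
Fact quot_scale1 : left_id 1 quot_scale.
Proof. by move=> x; case: (quot_pi_surj x) => v <-; rewrite quot_scale_pi scale1r. Qed.
Fact quot_scaleDr : right_distributive quot_scale +%R.
Proof.
move=> a x y; case: (quot_pi_surj x) => v <-; case: (quot_pi_surj y) => w <-.
by rewrite -quot_piD !quot_scale_pi -quot_piD scalerDr.
Qed.
Fact quot_scaleDl x : {morph quot_scale^~ x : a b / a + b}.
Proof.
move=> a b; case: (quot_pi_surj x) => v <-.
by rewrite !quot_scale_pi -quot_piD scalerDl.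
Qed.
HB.instance Definition _ := GRing.Zmodule_isLmodule.Build A quotmod
  quot_scaleA quot_scale1 quot_scaleDr quot_scaleDl.

Lemma quot_proj_subproof : linear quot_pi.
Proof. by apply: linear_of_addZ => [|a x]; [exact: quot_piD|rewrite -quot_scale_pi]. Qed.
Definition quot_proj : {linear V -> quotmod} := mklin quot_proj_subproof.

Lemma quot_proj_surj : surj quot_proj. Proof. exact: quot_pi_surj. Qed.
Lemma quot_proj0 v : quot_proj v = 0 <-> W v.
Proof. by rewrite -(linear0 quot_proj) quot_pi_eq subr0. Qed.

End Sub.

(** The form in which projectivity is used: the target of the lifting problem is
    the image of [f], so [f] itself need not be surjective. *)
Lemma proj_lift (P V U : lmodType A) (f : {linear U -> V}) (a : {linear P -> V}) :
  projective P -> (forall p, exists u, f u = a p) ->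
  exists b : {linear P -> U}, forall p, f (b p) = a p.
Proof.
move=> Pproj im_a; pose I := im_submod f.
have If u : I (f u) by apply/im_submodE; exists u.
have Ia p : I (a p) by apply/im_submodE.
pose f' := corestr If; pose a' := corestr Ia.
have f'surj : surj f'.
  move=> x; have /im_submodE[u fu] := sub_inclP x; exists u.
  by exact: sub_incl_inj.
have [b bE] := Pproj _ _ f' a' f'surj.
by exists b => p; rewrite -(corestrE If) bE.
Qed.

Definition retract (X Z : lmodType A) : Prop :=
  exists (i : {linear X -> Z}) (r : {linear Z -> X}), forall x, r (i x) = x.

Lemma projective_retract X Z : retract X Z -> projective Z -> projective X.
Proof.
move=> [i [r irK]] Zproj V W g f g_surj.
have [h hE] := Zproj _ _ g (lin_comp f r) g_surj.
by exists (lin_comp h i) => x; rewrite linE hE linE irK.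
Qed.

Lemma projective_prod X Y : projective X -> projective Y -> @projective A (X * Y)%type.
Proof.
move=> Xproj Yproj V W g f g_surj.
have [h hE] := Xproj _ _ g (lin_comp f (lin_inl X Y)) g_surj.
have [k kE] := Yproj _ _ g (lin_comp f (lin_inr X Y)) g_surj.
exists (lin_case h k) => -[x y]; rewrite linE /= linearD hE kE !linE -linearD.
by congr (f _); congr pair; rewrite /= ?addr0 ?add0r.
Qed.

Lemma fg_surj X Y (f : {linear X -> Y}) :
  surj f -> finitely_generated X -> finitely_generated Y.
Proof.
move=> f_surj [n [g gP]]; exists n, (fun i => f (g i)) => y.
have [x <-] := f_surj y; have [c ->] := gP x; exists c.
by rewrite linear_sum; apply: eq_bigr => i _; rewrite linearZ.
Qed.

Lemma fg_retract X Z : retract X Z -> finitely_generated Z -> finitely_generated X.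
Proof. by move=> [i [r irK]]; apply: (@fg_surj _ _ r) => x; exists (i x). Qed.

Lemma fg_prod (X Y : lmodType A) :
  finitely_generated X -> finitely_generated Y -> @finitely_generated A (X * Y)%type.
Proof.
move=> [m [g gP]] [n [h hP]].
exists (m + n)%N, (fun i => match split i with inl j => (g j, 0) | inr j => (0, h j) end).
move=> [x y]; have [c ->] := gP x; have [d ->] := hP y.
exists (fun i => match split i with inl j => c j | inr j => d j end).
have splitl (i : 'I_m) : split (lshift n i) = inl i := unsplitK (inl i).
have splitr (i : 'I_n) : split (rshift m i) = inr i := unsplitK (inr i).
rewrite big_split_ord /=.
rewrite (eq_bigr (fun i => lin_inl X Y (c i *: g i))); last first.
  by move=> i _; rewrite linearZ linE splitl.
rewrite [X in _ = _ + X](eq_bigr (fun i => lin_inr X Y (d i *: h i))); last first.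
  by move=> i _; rewrite linearZ linE splitr.
rewrite -!linear_sum !linE; congr pair; rewrite /= ?addr0 ?add0r //.
Qed.

Definition zeromod : lmodType A := 'rV[A]_0.
Lemma zeromodE (x : zeromod) : x = 0.
Proof. exact: thinmx0. Qed.
Lemma projective_zeromod : projective zeromod.
Proof.
by move=> V W g f _; exists (lin_zero _ _) => p; rewrite (zeromodE p) !linear0.
Qed.
Lemma fg_zeromod : finitely_generated zeromod.
Proof. by exists 0%N, (fun=> 0) => x; exists (fun=> 0); rewrite big_ord0 (zeromodE x). Qed.

End Basic.

(** * Projective resolutions *)

(** Chain maps and homotopies are built degree by degree; [good] is the invariant
    that makes the next step possible. *)
Lemma dependent_choice (T : nat -> Type) (good : forall j, T j -> Prop)
    (next : forall j, T j -> T j.+1 -> Prop) (start : T 0 -> Prop) :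
    (exists x, start x /\ good 0 x) ->
    (forall j x, good j x -> exists y, next j x y /\ good j.+1 y) ->
  exists s : forall j, T j, start (s 0) /\ forall j, next j (s j) (s j.+1).
Proof.
move=> ex0 step; have [x0 [start0 good0]] := cid ex0.
pose ex_next j (x : {x : T j | good j x}) := cid (step j (sval x) (svalP x)).
pose s := fix s j : {x : T j | good j x} :=
  match j with
  | 0 => exist _ x0 good0
  | j'.+1 => let y := ex_next j' (s j') in exist _ (sval y) (proj2 (svalP y))
  end.
by exists (fun j => sval (s j)); split=> //= j; case: (ex_next _ _) => y [].
Qed.

Arguments res_projective {A X} p i.
Arguments res_aug_surj {A X} p.
Arguments res_exact0 {A X} p.
Arguments res_exactS {A X} p i.

Section Resolutions.
Variable A : pzRingType.
Implicit Types X Y Z K F : lmodType A.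

Definition short_exact K F X (i : {linear K -> F}) (p : {linear F -> X}) : Prop :=
  [/\ injective i, exact_at i p & surj p].

Lemma res_aug_d X (P : proj_resolution X) x : res_aug P (res_d P 0 x) = 0.
Proof. by apply/res_exact0; exists x. Qed.

Lemma res_dd X (P : proj_resolution X) j x : res_d P j (res_d P j.+1 x) = 0.
Proof. by apply/res_exactS; exists x. Qed.

Definition pd_le n X : Prop := exists P : proj_resolution X, res_length_le P n.

Definition fgres_le n X : Prop := exists P : proj_resolution X,
  res_length_le P n /\ forall i, finitely_generated (P i).

Lemma fgresP X : has_finite_fg_proj_resolution X <-> exists n, fgres_le n X.
Proof. by split=> [[P [n]]|[n [P]]]; [exists n, P|exists P, n]. Qed.

Section ConsRes.
Variables (K F X : lmodType A) (i : {linear K -> F}) (p : {linear F -> X}).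
Hypotheses (ip : short_exact i p) (Fproj : projective F) (Q : proj_resolution K).

Definition cons_obj j : lmodType A := if j is j'.+1 then Q j' else F.
Definition cons_d j : {linear cons_obj j.+1 -> cons_obj j} :=
  match j return {linear cons_obj j.+1 -> cons_obj j} with
  | 0 => lin_comp i (res_aug Q)
  | j'.+1 => res_d Q j'
  end.

Lemma cons_projective j : projective (cons_obj j).
Proof. by case: j => [|j] //=; exact: res_projective. Qed.

Lemma cons_exact0 : exact_at (cons_d 0) p.
Proof.
case: ip => i_inj ex_ip _ v; rewrite ex_ip; split=> [[k <-]|[x <-]].
  by have [x <-] := res_aug_surj Q k; exists x.
by exists (res_aug Q x).
Qed.

Lemma cons_exactS j : exact_at (cons_d j.+1) (cons_d j).
Proof.
case: j => [|j] v /=; last exact: res_exactS.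
rewrite linE -res_exact0; split=> [|->]; last exact: linear0.
by case: ip => i_inj _ _ => iv0; apply: i_inj; rewrite iv0 linear0.
Qed.

Definition cons_res : proj_resolution X :=
  ProjResolution cons_projective (let: And3 _ _ s := ip in s) cons_exact0 cons_exactS.

End ConsRes.

(** Dropping degree 0 of a resolution leaves a resolution of the kernel of the
    augmentation, with terms [P j.+1] by conversion. *)
Section ShiftRes.
Variables (X : lmodType A) (P : proj_resolution X).

Definition syz : lmodType A := subtype (ker_submod (res_aug P)).
Definition syz_incl : {linear syz -> P 0%N} := sub_incl _.

Lemma syz_exact : short_exact syz_incl (res_aug P).
Proof.
split; [exact: sub_incl_inj| |exact: res_aug_surj].
by move=> v; rewrite -sub_incl_ex ker_submodE.
Qed.

Lemma shift_aug_subproof u : ker_submod (res_aug P) (res_d P 0 u).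
Proof. exact/ker_submodE/res_aug_d. Qed.
Definition shift_aug : {linear P 1%N -> syz} := corestr shift_aug_subproof.
Lemma shift_augE x : syz_incl (shift_aug x) = res_d P 0 x. Proof. by []. Qed.

Lemma shift_aug_surj : surj shift_aug.
Proof.
move=> k; have /ker_submodE/res_exact0[x xE] := sub_inclP k.
by exists x; apply: sub_incl_inj.
Qed.
Lemma shift_exact0 : exact_at (res_d P 1) shift_aug.
Proof.
move=> v; rewrite -res_exactS; split=> [v0|dv0]; first by rewrite -shift_augE v0 linear0.
by apply: sub_incl_inj; rewrite linear0.
Qed.
Definition shift_res : proj_resolution syz :=
  @ProjResolution A syz (fun j => P j.+1) (fun j => res_d P j.+1) shift_aug
   (fun j => res_projective P j.+1) shift_aug_surj shift_exact0
   (fun j => res_exactS P j.+1).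

End ShiftRes.

Section BaseRes.
Variables (X : lmodType A) (Xproj : projective X).
Definition base_obj j : lmodType A := if j is 0 then X else zeromod A.
Lemma base_projective j : projective (base_obj j).
Proof. by case: j => //= j; exact: projective_zeromod. Qed.
Lemma base_surj : surj (lin_id X). Proof. by move=> x; exists x. Qed.
Lemma base_exact0 : exact_at (lin_zero (base_obj 1) (base_obj 0)) (lin_id X).
Proof. by move=> x; rewrite linE; split=> [->|[y <-]] //; exists 0. Qed.
Lemma base_exactS j :
  exact_at (lin_zero (base_obj j.+2) (base_obj j.+1)) (lin_zero (base_obj j.+1) (base_obj j)).
Proof. by move=> x; split=> // _; exists 0; rewrite (zeromodE x). Qed.
Definition base_res : proj_resolution X :=
  ProjResolution base_projective base_surj base_exact0 base_exactS.
End BaseRes.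

Lemma pd_le_cons n K F X (i : {linear K -> F}) (p : {linear F -> X}) :
  short_exact i p -> projective F -> pd_le n K -> pd_le n.+1 X.
Proof.
by move=> ip Fproj [Q Qn]; exists (cons_res ip Fproj Q) => -[|j] //; exact: Qn.
Qed.

Lemma pd_le0 X : projective X -> pd_le 0 X.
Proof. by move=> Xproj; exists (base_res Xproj) => -[|j] // _ x; exact: zeromodE. Qed.

Lemma fgres_le_cons n K F X (i : {linear K -> F}) (p : {linear F -> X}) :
    short_exact i p -> projective F -> finitely_generated F -> fgres_le n K ->
  fgres_le n.+1 X.
Proof.
move=> ip Fproj Ffg [Q [Qn Qfg]]; exists (cons_res ip Fproj Q).
by split=> -[|j] //; [exact: Qn|exact: Qfg].
Qed.

Lemma fgres_le0 X : projective X -> finitely_generated X -> fgres_le 0 X.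
Proof.
move=> Xproj Xfg; exists (base_res Xproj).
by split=> -[|j] //; [move=> _ x; exact: zeromodE|exact: fg_zeromod].
Qed.

Lemma shift_length n X (P : proj_resolution X) :
  res_length_le P n.+1 -> res_length_le (shift_res P) n.
Proof. by move=> Pn j nj; exact: Pn. Qed.

Lemma pd_le_leq m n X : (m <= n)%N -> pd_le m X -> pd_le n X.
Proof. by move=> mn [P Pm]; exists P => j nj; exact/Pm/leq_ltn_trans/nj. Qed.

(** The resolution can be cut at [n]: [res_d P n \o k] is idempotent with the
    same image as [res_d P n], so the cokernel of [res_d P n] is a direct summand
    of [P n]. Passing to syzygies reduces to [n = 0], where this cokernel is
    [X]. *)
Lemma pd_le_split n X (P : proj_resolution X) (k : {linear P n -> P n.+1}) :
  (forall x, res_d P n (k (res_d P n x)) = res_d P n x) -> pd_le n X.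
Proof.
elim: n X P k => [|n IHn] X P k dkd; last first.
  apply: (pd_le_cons (syz_exact P) (res_projective P 0)).
  exact: (IHn _ (shift_res P) k dkd).
apply/pd_le0/projective_retract/res_projective.
have [s sE] : exists s : {linear X -> P 0%N}, forall x,
    s (res_aug P x) = lin_sub (lin_id _) (lin_comp (res_d P 0) k) x.
  apply: lin_factor => [|x /res_exact0[y <-]]; first exact: res_aug_surj.
  by rewrite !linE dkd subrr.
exists s, (res_aug P) => x; have [y <-] := res_aug_surj P x.
by rewrite sE !linE linearB /= res_aug_d subr0.
Qed.

(** ** Comparison of resolutions *)

Section Comparison.
Variables (X Z : lmodType A) (P : proj_resolution X) (Q : proj_resolution Z).

Lemma chain_lift (f : {linear X -> Z}) :
  exists phi : forall j, {linear P j -> Q j},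
    (forall x, res_aug Q (phi 0 x) = f (res_aug P x)) /\
    forall j x, res_d Q j (phi j.+1 x) = phi j (res_d P j x).
Proof.
(* invariant: [phi \o d] takes values in the boundaries of [Q] *)
apply: (@dependent_choice (fun j => {linear P j -> Q j})
  (fun j phi => forall x, exists y, res_d Q j y = phi (res_d P j x))
  (fun j phi psi => forall x, res_d Q j (psi x) = phi (res_d P j x))
  (fun phi => forall x, res_aug Q (phi x) = f (res_aug P x))).
- have [b bE] := proj_lift (f := res_aug Q) (a := lin_comp f (res_aug P))
    (res_projective P 0) (fun p => res_aug_surj Q _).
  exists b; split=> // x; apply/res_exact0.
  by rewrite bE linE res_aug_d linear0.
- move=> j phi phi_good.
  have [b bE] := proj_lift (a := lin_comp phi (res_d P j)) (res_projective P j.+1) phi_good.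
  exists b; split=> // x; apply/res_exactS.
  by rewrite bE linE res_dd linear0.
Qed.

Lemma null_homotopy (chi : forall j, {linear P j -> Q j}) :
    (forall x, res_aug Q (chi 0 x) = 0) ->
    (forall j x, res_d Q j (chi j.+1 x) = chi j (res_d P j x)) ->
  exists h : forall j, {linear P j -> Q j.+1},
    (forall x, res_d Q 0 (h 0 x) = chi 0 x) /\
    forall j x, res_d Q j.+1 (h j.+1 x) = chi j.+1 x - h j (res_d P j x).
Proof.
move=> chi0 chiS.
(* invariant: [chi - h \o d] takes values in the boundaries of [Q] *)
apply: (@dependent_choice (fun j => {linear P j -> Q j.+1})
  (fun j h => forall x, exists y, res_d Q j.+1 y = chi j.+1 x - h (res_d P j x))
  (fun j h k => forall x, res_d Q j.+1 (k x) = chi j.+1 x - h (res_d P j x))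
  (fun h => forall x, res_d Q 0 (h x) = chi 0 x)).
- have [p|b bE] := proj_lift (f := res_d Q 0) (a := chi 0) (res_projective P 0).
    exact/res_exact0.
  by exists b; split=> // x; apply/res_exactS; rewrite linearB /= bE chiS subrr.
- move=> j h h_good; have [b bE] := proj_lift
    (a := lin_sub (chi j.+1) (lin_comp h (res_d P j))) (res_projective P j.+1) h_good.
  exists b; split=> [x|x]; first by rewrite bE.
  by apply/res_exactS; rewrite linearB /= chiS bE !linE res_dd linear0 subr0 subrr.
Qed.

End Comparison.

(** Lift the inclusion and the retraction to chain maps [phi] and [psi]; then
    [1 - psi \o phi] lifts the zero map of [X], so it is null-homotopic by some
    [h]. The case [X = Z] compares two resolutions of the same module. *)
Lemma retract_resolution X Z (P : proj_resolution X) (Q : proj_resolution Z) :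
    retract X Z ->
  exists (phi : forall j, {linear P j -> Q j}) (psi : forall j, {linear Q j -> P j})
         (h : forall j, {linear P j -> P j.+1}),
  [/\ forall j x, res_d Q j (phi j.+1 x) = phi j (res_d P j x),
      forall j y, res_d P j (psi j.+1 y) = psi j (res_d Q j y)
    & forall j x, x = psi j.+1 (phi j.+1 x)
                      + (res_d P j.+1 (h j.+1 x) + h j (res_d P j x))].
Proof.
move=> [i [r irK]]; have [phi [phi0 phiS]] := chain_lift P Q i.
have [psi [psi0 psiS]] := chain_lift Q P r.
pose chi j := lin_sub (lin_id (P j)) (lin_comp (psi j) (phi j)).
have [||h [h0 hS]] := @null_homotopy _ _ P P chi.
- by move=> x; rewrite !linE linearB /= psi0 phi0 irK subrr.
- by move=> j x; rewrite !linE linearB /= psiS phiS.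
exists phi, psi, h; split=> // j x.
by rewrite hS !linE subrK addrC subrK.
Qed.

(** ** Mapping cones and products *)

Section Cone.
Variables (K F X : lmodType A) (i : {linear K -> F}) (p : {linear F -> X}).
Variables (B : proj_resolution K) (C : proj_resolution F).
Variable phi : forall j, {linear B j -> C j}.
Hypotheses (ip : short_exact i p).
Hypothesis phi0 : forall x, res_aug C (phi 0 x) = i (res_aug B x).
Hypothesis phiS : forall j x, res_d C j (phi j.+1 x) = phi j (res_d B j x).

Definition cone_obj j : lmodType A :=
  if j is j'.+1 then (C j * B j')%type : lmodType A else C 0%N.
Definition cone_d j : {linear cone_obj j.+1 -> cone_obj j} :=
  match j return {linear cone_obj j.+1 -> cone_obj j} with
  | 0 => lin_case (res_d C 0) (phi 0)
  | j'.+1 => lin_pair (lin_case (res_d C j'.+1) (phi j'.+1))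
                      (lin_opp (lin_comp (res_d B j') (lin_snd _ _)))
  end.
Lemma cone_d0E c b : cone_d 0 (c, b) = res_d C 0 c + phi 0 b. Proof. by []. Qed.
Lemma cone_dSE j c b : cone_d j.+1 (c, b)
  = (res_d C j.+1 c + phi j.+1 b, - res_d B j b).
Proof. by []. Qed.

Definition cone_aug : {linear cone_obj 0 -> X} := lin_comp p (res_aug C).

Lemma cone_projective j : projective (cone_obj j).
Proof.
case: j => [|j]; first exact: res_projective.
by apply: projective_prod; exact: res_projective.
Qed.

Lemma cone_aug_surj : surj cone_aug.
Proof.
case: ip => _ _ p_surj x; have [y <-] := p_surj x.
by have [z <-] := res_aug_surj C y; exists z.
Qed.

Lemma cone_exact0 : exact_at (cone_d 0) cone_aug.
Proof.
case: ip => i_inj ex_ip _ c; rewrite linE ex_ip; split=> [[k]|[[c1 b] <-]].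
  have [b <-] := res_aug_surj B k; rewrite -phi0 => phib.
  have /(res_exact0 C)[c1 c1E] : res_aug C (c - phi 0%N b) = 0 by rewrite linearB /= phib subrr.
  by exists (c1, b); rewrite cone_d0E c1E subrK.
by exists (res_aug B b); rewrite cone_d0E linearD /= res_aug_d add0r phi0.
Qed.

Lemma cone_dd j c : cone_d j (cone_d j.+1 c) = 0.
Proof.
case: c => c b; rewrite cone_dSE; case: j c b => [|j] c b.
  by rewrite cone_d0E linearD linearN /= res_dd add0r phiS subrr.
rewrite cone_dSE linearD linearN /= res_dd add0r phiS subrr.
by rewrite linearN /= res_dd !oppr0.
Qed.

Lemma cone_exactS j : exact_at (cone_d j.+1) (cone_d j).
Proof.
move=> c; split=> [|[c' <-]]; last exact: cone_dd.
case: c => c b dcb.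
have [b2 b2E] : exists b2, res_d B j b2 = b.
  case: j c b dcb => [|j] c b; last first.
    by rewrite cone_dSE => -[_ /eqP]; rewrite oppr_eq0 => /eqP /res_exactS.
  rewrite cone_d0E => cb; apply/res_exact0; case: ip => i_inj _ _.
  apply: i_inj; rewrite linear0 -phi0 -[RHS](linear0 (res_aug C)) -cb.
  by rewrite linearD /= res_aug_d add0r.
have [c2 c2E] : exists c2, res_d C j.+1 c2 = c + phi j.+1 b2.
  apply/res_exactS; rewrite linearD /= phiS b2E.
  by case: j c b b2 dcb {b2E} => [|j] c b b2 //= [].
by exists (c2, - b2); rewrite cone_dSE c2E !linearN /= b2E addrK opprK.
Qed.

Definition cone_res : proj_resolution X :=
  ProjResolution cone_projective cone_aug_surj cone_exact0 cone_exactS.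

End Cone.

Section ProdRes.
Variables (X Y : lmodType A) (P : proj_resolution X) (Q : proj_resolution Y).

Definition lin_prod (U V U' V' : lmodType A) (f : {linear U -> V}) (g : {linear U' -> V'}) :
    {linear (U * U')%type -> (V * V')%type} :=
  lin_pair (lin_comp f (lin_fst _ _)) (lin_comp g (lin_snd _ _)).

Lemma surj_prod (U V U' V' : lmodType A) (f : {linear U -> V}) (g : {linear U' -> V'}) :
  surj f -> surj g -> surj (lin_prod f g).
Proof.
move=> f_surj g_surj [x y]; have [u <-] := f_surj x; have [v <-] := g_surj y.
by exists (u, v).
Qed.

Lemma exact_prod (U V W U' V' W' : lmodType A)
    (f : {linear U -> V}) (g : {linear V -> W})
    (f' : {linear U' -> V'}) (g' : {linear V' -> W'}) :
  exact_at f g -> exact_at f' g' -> exact_at (lin_prod f f') (lin_prod g g').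
Proof.
move=> ex ex' [v v']; rewrite /lin_prod !linE; split=> [[gv gv']|[[u u']]].
  have [u uE] := (ex v).1 gv; have [u' u'E] := (ex' v').1 gv'.
  by exists (u, u'); rewrite !linE /= uE u'E.
rewrite !linE => -[uE u'E]; congr pair.
  by apply/ex; exists u.
by apply/ex'; exists u'.
Qed.

Definition prod_res : proj_resolution (X * Y)%type :=
  @ProjResolution A (X * Y)%type (fun j => (P j * Q j)%type)
    (fun j => lin_prod (res_d P j) (res_d Q j))
    (lin_prod (res_aug P) (res_aug Q))
    (fun j => projective_prod (res_projective P j) (res_projective Q j))
    (surj_prod (res_aug_surj P) (res_aug_surj Q))
    (exact_prod (res_exact0 P) (res_exact0 Q))
    (fun j => exact_prod (res_exactS P j) (res_exactS Q j)).

End ProdRes.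

(** ** Modules with a finite resolution by finitely generated projectives *)

Lemma fgres_le_leq m n X : (m <= n)%N -> fgres_le m X -> fgres_le n X.
Proof.
by move=> mn [P [Pm Pfg]]; exists P; split=> // j nj; exact/Pm/leq_ltn_trans/nj.
Qed.

Lemma fgres_le_prod n X Y : fgres_le n X -> fgres_le n Y -> @fgres_le n (X * Y)%type.
Proof.
move=> [P [Pn Pfg]] [Q [Qn Qfg]]; exists (prod_res P Q).
split=> [j nj [x y]|j]; last exact: fg_prod.
by rewrite (Pn j nj x) (Qn j nj y).
Qed.

(** The endomorphism [i \o r] of [Z] lifts to some [e] on [P 0]. If [L] is the
    kernel of [P 0 -> Z -> X], the maps [x |-> (e x, x)] and
    [(k, y) |-> k + (y - e y)] make [L] a direct summand of [syz P * P 0], which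
    has a resolution of length one less. *)
Lemma fgres_le_retract n X Z : retract X Z -> fgres_le n Z -> fgres_le n X.
Proof.
move=> [i [r irK]] [P [Pn Pfg]]; elim: n X Z i r irK P Pn Pfg => [|n IHn] X Z i r irK P Pn Pfg.
  have P0 : retract X (P 0%N).
    have [s sE] : exists s : {linear Z -> P 0%N}, forall x, s (res_aug P x) = lin_id _ x.
      apply: lin_factor => [|x /res_exact0[y <-]]; first exact: res_aug_surj.
      by rewrite (Pn 1%N isT y) !linear0.
    exists (lin_comp s i), (lin_comp r (res_aug P)) => x; rewrite !linE.
    by have [y yE] := res_aug_surj P (i x); rewrite -yE sE linE yE irK.
  apply: fgres_le0; first exact: projective_retract (res_projective P 0).
  exact: fg_retract P0 (Pfg 0%N).
pose p := lin_comp r (res_aug P).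
have p_surj : surj p.
  move=> x; have [y yE] := res_aug_surj P (i x); exists y.
  by rewrite linE yE irK.
pose L := ker_submod p.
have ex_L : short_exact (sub_incl L) p.
  by split=> //; [exact: sub_incl_inj|move=> v; rewrite -sub_incl_ex ker_submodE].
have [e eE] := proj_lift (f := res_aug P) (a := lin_comp i p) (res_projective P 0)
  (fun x => res_aug_surj P _).
apply: (fgres_le_cons ex_L) => //; first exact: res_projective.
have fgK : fgres_le n (syz P).
  by exists (shift_res P); split=> [|j]; [exact: shift_length|exact: Pfg].
have fgKP : @fgres_le n (syz P * P 0%N)%type.
  apply: fgres_le_prod => //; apply: (@fgres_le_leq 0) => //.
  by apply: fgres_le0; [exact: res_projective|exact: Pfg].
have pE (x : subtype L) : p (sub_incl L x) = 0 by exact: (@sub_inclP _ _ L x).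
have aK x : ker_submod (res_aug P) (lin_comp e (sub_incl L) x).
  by apply/ker_submodE; rewrite linE eE linE pE linear0.
have bL y : ker_submod p (lin_sub (lin_id _) e y).
  by apply/ker_submodE; rewrite !linE !linearB /= eE !linE irK subrr.
have kL (k : syz P) : ker_submod p (syz_incl P k).
  by apply/ker_submodE; rewrite linE; have /ker_submodE -> := sub_inclP k; exact: linear0.
pose j := lin_pair (corestr aK) (sub_incl L).
pose q := lin_case (corestr kL) (corestr bL).
case: fgKP => Q [Qn Qfg]; apply: (IHn _ _ j q _ Q Qn Qfg) => x.
by apply: sub_incl_inj; rewrite !linE linearD /= addrC subrK.
Qed.

End Resolutions.

(** * Finitistic dimension *)

Lemma enat_least_leP (P : nat -> Prop) n :
  (enat_least P <= Fin n)%enat <-> exists2 m, (m <= n)%N & P m.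
Proof.
rewrite /enat_least; case: pselect => [exP|nexP] /=.
  case: ex_minnP => m /asboolP Pm m_min; split=> [mn|[k kn Pk]]; first by exists m.
  by apply: leq_trans kn; apply/m_min/asboolP.
by split=> // -[m _ Pm]; case: nexP; exists m; apply/asboolP.
Qed.

Section Findim.
Variable A : pzRingType.
Implicit Types X K F : lmodType A.

Lemma proj_dim_leP X n : (proj_dim X <= Fin n)%enat <-> pd_le n X.
Proof.
rewrite enat_least_leP; split=> [[m mn]|]; last by exists n.
exact: pd_le_leq.
Qed.

Lemma findim_leP n : (findim A <= Fin n)%enat <->
  forall X, has_finite_fg_proj_resolution X -> pd_le n X.
Proof.
rewrite enat_least_leP; split=> [[m mn sup_m] X fgX|pd_n].
  apply/(pd_le_leq mn)/proj_dim_leP/sup_m; by exists X.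
by exists n => // e [X [fgX ->]]; apply/proj_dim_leP/pd_n.
Qed.

(** The complex resolves the cokernel of [d 0], whose projective dimension is at
    most [n]; comparing it with a resolution that vanishes above degree [n]
    gives the contraction. *)
Lemma findim_contraction n (E : nat -> lmodType A)
    (d : forall j, {linear E j.+1 -> E j}) N :
    (findim A <= Fin n)%enat ->
    (forall j, projective (E j)) -> (forall j, finitely_generated (E j)) ->
    (forall j, exact_at (d j.+1) (d j)) ->
    (forall j, (N < j)%N -> forall x : E j, x = 0) ->
  exists h : forall j, {linear E j -> E j.+1},
    forall j, (n <= j)%N -> forall x, x = d j.+1 (h j.+1 x) + h j (d j x).
Proof.
move=> /findim_leP findimA Eproj Efg Eex EN.
pose X : lmodType A := quotmod (im_submod (d 0)).
have ex0 : exact_at (d 0) (quot_proj (im_submod (d 0))).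
  by move=> v; rewrite quot_proj0 im_submodE.
pose P : proj_resolution X := ProjResolution Eproj (@quot_proj_surj _ _ _) ex0 Eex.
have [|Q Qn] := findimA X; first by exists P, N; split.
have [|phi [psi [h [_ _ hE]]]] := @retract_resolution _ X X P Q.
  by exists (lin_id X), (lin_id X).
exists h => j nj x; rewrite {1}(hE j x).
by rewrite (Qn j.+1 nj (phi j.+1 x)) linear0 add0r.
Qed.

(** By the mapping cone of a chain map that lifts [i]. *)
Lemma fgres_le_cokernel m n K F X (i : {linear K -> F}) (p : {linear F -> X}) :
  short_exact i p -> fgres_le m K -> fgres_le n F -> fgres_le (maxn m.+1 n) X.
Proof.
move=> ip [B [Bm Bfg]] [C [Cn Cfg]].
have [phi [phi0 phiS]] := chain_lift B C i.
exists (cone_res ip phi0 phiS); split=> [[|j]|[|j]] //; [|exact: Cfg|exact: fg_prod].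
rewrite gtn_max => /andP[mj nj] [c b].
by rewrite (Cn _ nj c) (Bm _ mj b).
Qed.

(** For properties known of the regular module: a finitely generated projective
    module is a direct summand of one of its finite powers. *)
Lemma fg_projective_ind (C : lmodType A -> Prop) :
    C (A^o : lmodType A) -> (forall X Y, C X -> C Y -> C (X * Y)%type) ->
    (forall X Z, retract X Z -> C Z -> C X) ->
  forall P, projective P -> finitely_generated P -> C P.
Proof.
move=> C1 CM Cretract P Pproj [n [g gP]].
suff [F CF [f f_gen]] : exists2 F, C F & exists f : {linear F -> P},
    forall c : 'I_n -> A, exists x, f x = \sum_(i < n) c i *: g i.
  have [|s sE] := Pproj _ _ f (lin_id P).
    by move=> y; have [c ->] := gP y.
  by apply: Cretract CF; exists s, f.
elim: n g {gP} => [|n IHn] g.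
  by exists (A^o : lmodType A) => //; exists (lin_zero _ _) => c; exists 0; rewrite big_ord0.
have [F CF [f f_gen]] := IHn (fun i => g (fintype.lift ord0 i)).
have lin_g : linear ((fun a => (a : A) *: g ord0) : A^o -> P).
  by move=> a x y; rewrite scalerDl scalerA.
exists ((A^o : lmodType A) * F)%type; first exact: CM.
exists (lin_case (mklin lin_g) f) => c; rewrite big_ord_recl.
by have [x <-] := f_gen (fun i => c (fintype.lift ord0 i)); exists (c ord0, x).
Qed.

End Findim.

(** * Right exact functors and vanishing of their left derived functors *)

(** Right exact additive functors to abelian groups. The laws range over all
    linear maps with the prescribed values, so that no equality between bundled
    linear maps is ever needed. *)
Record rexfunctor (A : pzRingType) := RexFunctor {
  fobj :> lmodType A -> zmodType;
  fmap : forall U V : lmodType A, {linear U -> V} -> fobj U -> fobj V;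
  fmapD : forall (U V : lmodType A) (f : {linear U -> V}) s t, fmap f (s + t) = fmap f s + fmap f t;
  fmap_id : forall (U : lmodType A) (f : {linear U -> U}), (forall x, f x = x) -> forall t, fmap f t = t;
  fmap_comp : forall (U V W : lmodType A) (f : {linear U -> V}) (g : {linear V -> W}) (h : {linear U -> W}),
    (forall x, h x = g (f x)) -> forall t, fmap h t = fmap g (fmap f t);
  fmap_add : forall (U V : lmodType A) (f g h : {linear U -> V}),
    (forall x, h x = f x + g x) -> forall t, fmap h t = fmap f t + fmap g t;
  fmap_rex : forall (U V W : lmodType A) (f : {linear U -> V}) (g : {linear V -> W}),
    exact_at f g -> surj g -> exact_at (fmap f) (fmap g) /\ surj (fmap g)
}.
Arguments fmap {A} r {U V} f t.
Arguments fmapD {A} r {U V} f s t.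
Arguments fmap_id {A} r {U} f _ t.
Arguments fmap_comp {A} r {U V W} f g h _ t.
Arguments fmap_add {A} r {U V} f g h _ t.
Arguments fmap_rex {A} r {U V W f g} _ _.

Section Derived.
Variables (A : pzRingType) (G : rexfunctor A).
Implicit Types U V W X Y Z K F : lmodType A.

Lemma fmap0 U V (f : {linear U -> V}) : fmap G f 0 = 0.
Proof. by apply: (addrI (fmap G f 0)); rewrite -fmapD !addr0. Qed.
Lemma fmapN U V (f : {linear U -> V}) t : fmap G f (- t) = - fmap G f t.
Proof. by apply: (addrI (fmap G f t)); rewrite -fmapD !subrr fmap0. Qed.
Lemma fmapB U V (f : {linear U -> V}) s t : fmap G f (s - t) = fmap G f s - fmap G f t.
Proof. by rewrite fmapD fmapN. Qed.

Lemma fmap_zero U V (f : {linear U -> V}) : (forall x, f x = 0) ->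
  forall t, fmap G f t = 0.
Proof.
move=> f0 t; apply: (addrI (fmap G f t)); rewrite addr0; apply: esym.
by apply: fmap_add => x; rewrite !f0 addr0.
Qed.

Lemma fmap_opp U V (f g : {linear U -> V}) : (forall x, g x = - f x) ->
  forall t, fmap G g t = - fmap G f t.
Proof.
move=> gE t; apply/eqP; rewrite -addr_eq0 -(fmap_add G _ _ (lin_zero _ _)).
  by apply/eqP/fmap_zero => x.
by move=> x; rewrite linE gE addNr.
Qed.

Lemma fmap_complex U V W (f : {linear U -> V}) (g : {linear V -> W}) :
  (forall x, g (f x) = 0) -> forall t, fmap G g (fmap G f t) = 0.
Proof.
move=> gf0 t; rewrite -(fmap_comp G _ _ (lin_zero _ _)) ?fmap_zero //.
Qed.

Lemma fmap_prod U V (t : G (U * V)%type) : exists u v,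
  t = fmap G (lin_inl U V) u + fmap G (lin_inr U V) v.
Proof.
exists (fmap G (lin_fst U V) t), (fmap G (lin_snd U V) t).
rewrite -(fmap_comp G _ _ (lin_comp (lin_inl U V) (lin_fst U V))) //.
rewrite -(fmap_comp G _ _ (lin_comp (lin_inr U V) (lin_snd U V))) //.
rewrite -(fmap_add G _ _ (lin_id _)) ?fmap_id // => -[u v].
by rewrite !linE; congr pair; rewrite /= ?addr0 ?add0r.
Qed.

Definition exact_above n X (P : proj_resolution X) : Prop :=
  forall j, (n <= j)%N -> exact_at (fmap G (res_d P j.+1)) (fmap G (res_d P j)).

(** Vanishing on [X] of the left derived functors of [G] of degree greater than
    [n]. *)
Definition derived_vanish n X : Prop := forall P : proj_resolution X, exact_above n P.

Lemma exact_of_cycles U V W (f : {linear U -> V}) (g : {linear V -> W}) :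
    (forall x, g (f x) = 0) ->
    (forall t, fmap G g t = 0 -> exists s, fmap G f s = t) ->
  exact_at (fmap G f) (fmap G g).
Proof. by move=> gf0 cyc t; split=> [/cyc|[s <-]] //; exact: fmap_complex. Qed.

(** Chain maps and homotopies survive additive functors, so the homology of
    [G P] is a direct summand of that of [G Q]; one resolution of [Z] decides. *)
Lemma derived_vanish_of_res n X Z (Q : proj_resolution Z) :
  retract X Z -> exact_above n Q -> derived_vanish n X.
Proof.
move=> XZ Qn P j nj; have [phi [psi [h [phiS psiS hE]]]] := retract_resolution P Q XZ.
apply: exact_of_cycles => [x|t dt]; first exact: res_dd.
have [|s sE] := (Qn j nj (fmap G (phi j.+1) t)).1.
  rewrite -(fmap_comp G _ _ (lin_comp (phi j) (res_d P j))).
    by rewrite (fmap_comp G (res_d P j) (phi j)) // dt fmap0.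
  by move=> x; rewrite linE phiS.
exists (fmap G (psi j.+2) s + fmap G (h j.+1) t); rewrite fmapD.
rewrite -(fmap_comp G _ _ (lin_comp (psi j.+1) (res_d Q j.+1))); last first.
  by move=> x; rewrite linE psiS.
rewrite (fmap_comp G (res_d Q j.+1) (psi j.+1)) // sE.
have homE := fmap_add G (lin_comp (psi j.+1) (phi j.+1))
  (lin_add (lin_comp (res_d P j.+1) (h j.+1)) (lin_comp (h j) (res_d P j)))
  (lin_id _) (fun x => hE j x) t.
rewrite -[RHS](fmap_id G (lin_id _)) // homE.
rewrite -(fmap_comp G _ _ (lin_comp (psi j.+1) (phi j.+1))) //; congr (_ + _).
rewrite (fmap_add G (lin_comp (res_d P j.+1) (h j.+1))
  (lin_comp (h j) (res_d P j))) //.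
rewrite [X in _ = _ + X](fmap_comp G (res_d P j) (h j)) //.
rewrite dt fmap0 addr0; apply: esym; exact: fmap_comp.
Qed.

Lemma derived_vanish_retract n X Z (Q : proj_resolution Z) :
  retract X Z -> derived_vanish n Z -> derived_vanish n X.
Proof. by move=> XZ Zn; exact: (derived_vanish_of_res XZ (Zn Q)). Qed.

Lemma derived_vanish_pd n X : pd_le n X -> derived_vanish n X.
Proof.
move=> [Q Qn]; apply: (@derived_vanish_of_res _ X X Q).
  by exists (lin_id X), (lin_id X).
move=> j nj; apply: exact_of_cycles => [x|t _]; first exact: res_dd.
exists 0; rewrite fmap0 -[t](fmap_id G (lin_id _)) //; apply: esym.
by apply: fmap_zero => x; rewrite linE (Qn j.+1 nj x).
Qed.

Lemma exact_fmap_lin_prod U V W U' V' W' (f : {linear U -> V}) (g : {linear V -> W})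
    (f' : {linear U' -> V'}) (g' : {linear V' -> W'}) :
    (forall x, g (f x) = 0) -> (forall x, g' (f' x) = 0) ->
    exact_at (fmap G f) (fmap G g) -> exact_at (fmap G f') (fmap G g') ->
  exact_at (fmap G (lin_prod f f')) (fmap G (lin_prod g g')).
Proof.
move=> gf0 gf0' ex ex'; apply: exact_of_cycles => [[x x']|t].
  by rewrite /lin_prod !linE /= gf0 gf0'.
have [u [v ->]] := fmap_prod t => dt.
have du : fmap G g u = 0.
  rewrite -(fmap0 (lin_fst W W')) -dt -(fmap_comp G _ _ (lin_comp g (lin_fst _ _))) //.
  rewrite (fmap_comp G (lin_fst V V') g) // fmapD.
  rewrite -(fmap_comp G _ _ (lin_id _)) // (fmap_id _ (lin_id _)) //.
  by rewrite -(fmap_comp G _ _ (lin_zero _ _)) // (fmap_zero (f := lin_zero _ _)) // addr0.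
have dv : fmap G g' v = 0.
  rewrite -(fmap0 (lin_snd W W')) -dt -(fmap_comp G _ _ (lin_comp g' (lin_snd _ _))) //.
  rewrite (fmap_comp G (lin_snd V V') g') // fmapD.
  rewrite -(fmap_comp G _ _ (lin_zero _ _)) // (fmap_zero (f := lin_zero _ _)) // add0r.
  by rewrite -(fmap_comp G _ _ (lin_id _)) // (fmap_id _ (lin_id _)).
have [a aE] := (ex u).1 du; have [b bE] := (ex' v).1 dv.
exists (fmap G (lin_inl _ _) a + fmap G (lin_inr _ _) b); rewrite fmapD -aE -bE.
congr (_ + _).
  rewrite -(fmap_comp G f (lin_inl V V') (lin_comp (lin_inl V V') f)) //.
  apply: esym; apply: fmap_comp => x; rewrite /lin_prod !linE /=.
  by rewrite linear0.
rewrite -(fmap_comp G f' (lin_inr V V') (lin_comp (lin_inr V V') f')) //.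
apply: esym; apply: fmap_comp => x; rewrite /lin_prod !linE /=.
by rewrite linear0.
Qed.

Lemma derived_vanish_prod n X Y (P : proj_resolution X) (Q : proj_resolution Y) :
  derived_vanish n X -> derived_vanish n Y -> @derived_vanish n (X * Y)%type.
Proof.
move=> Xn Yn; apply: (@derived_vanish_of_res _ _ _ (prod_res P Q)).
  by exists (lin_id _), (lin_id _).
move=> j nj; apply: exact_fmap_lin_prod; [exact: res_dd|exact: res_dd| |].
  exact: Xn.
exact: Yn.
Qed.

End Derived.

Section DerivedShift.
Variables (A : pzRingType) (G : rexfunctor A).
Variables (K F X : lmodType A) (i : {linear K -> F}) (p : {linear F -> X}).
Variables (B : proj_resolution K) (C : proj_resolution F).
Hypotheses (ip : short_exact i p) (F_acyclic : derived_vanish G 0 F).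

(** Dimension shifting: [F] being acyclic, the image in [G C] of a cycle of [G B]
    bounds, and the cycle together with a bounding chain is a cycle of the mapping
    cone one degree higher. The cone resolves [X], so this cycle bounds there.
    In degree 0 there is no cycle condition on [G B], and right exactness turns
    the same argument into the injectivity of [G K -> G F]. *)
Lemma derived_vanish_shift n : derived_vanish G n X ->
  derived_vanish G n.-1 K /\ (n = 0%N -> forall k, fmap G i k = 0 -> k = 0).
Proof.
move=> Xn; have [phi [phi0 phiS]] := chain_lift B C i.
have coneP := Xn (cone_res ip phi0 phiS).
(* The cone has [C j.+1 * B j] in degree [j.+1]; this is the projection to the
   second factor of its exactness there. *)
have snd_bound j (b : G (B j)) (c : G (C j.+1)) :
    (n <= j)%N -> fmap G (res_d C j) c = fmap G (phi j) b ->
    (if j is j'.+1 return G (B j) -> Prop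
     then fun b => fmap G (res_d B j') b = 0 else fun=> True) b ->
  exists b', fmap G (res_d B j) b' = b.
  move=> nj dc db; pose z := fmap G (lin_inl (C j.+1) (B j)) c - fmap G (lin_inr _ _) b.
  have dz : fmap G (cone_d phi j) z = 0.
    rewrite /z fmapB; apply/eqP; rewrite subr_eq0; apply/eqP.
    case: j b c nj dc db {z} => [|j] b c _ dc db.
      rewrite -(fmap_comp G _ _ (res_d C 0)); last first.
        by move=> x; rewrite ?lin_inlE ?lin_inrE cone_d0E linear0 addr0.
      rewrite dc; apply: fmap_comp => x.
      by rewrite ?lin_inlE ?lin_inrE cone_d0E linear0 add0r.
    rewrite -(fmap_comp G _ _ (lin_comp (lin_inl _ _) (res_d C j.+1))); last first.
      by move=> x; rewrite ?lin_inlE ?lin_inrE cone_dSE !linear0 addr0.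
    rewrite (fmap_comp G (res_d C j.+1) (lin_inl _ _)) // dc.
    rewrite -[LHS]addr0 -(fmap_comp G _ _ (lin_comp (lin_inl _ _) (phi j.+1))) //.
    rewrite -(fmap_comp G _ _ (lin_add (lin_comp (lin_inl _ _) (phi j.+1))
        (lin_comp (lin_inr _ _) (lin_opp (res_d B j))))); last first.
      move=> x; rewrite ?lin_inlE ?lin_inrE cone_dSE !linE linear0 add0r.
      by congr pair; rewrite /= ?addr0 ?add0r.
    rewrite [RHS](fmap_add G (lin_comp (lin_inl _ _) (phi j.+1))
        (lin_comp (lin_inr _ _) (lin_opp (res_d B j)))) //; congr (_ + _).
    rewrite (fmap_comp G (lin_opp (res_d B j)) (lin_inr _ _)) //.
    by rewrite (fmap_opp (f := res_d B j)) // db oppr0 fmap0.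
  have [w wE] := (coneP j nj z).1 dz.
  exists (fmap G (lin_snd _ _) w).
  have sndw : fmap G (lin_snd _ _) (fmap G (cone_d phi j.+1) w)
      = fmap G (lin_snd (C j.+1) (B j)) z by congr (fmap G _ _).
  apply: oppr_inj; rewrite -(fmap_comp G _ _ (lin_comp (res_d B j) (lin_snd _ _))) //.
  rewrite -(fmap_opp (g := lin_comp (lin_snd _ _) (cone_d phi j.+1))) //.
  rewrite (fmap_comp G (cone_d phi j.+1) (lin_snd _ _)) // sndw /z fmapB.
  rewrite -(fmap_comp G _ _ (lin_zero _ _)) // (fmap_zero _ (f := lin_zero _ _)) //.
  by rewrite -(fmap_comp G _ _ (lin_id _)) // (fmap_id _ (lin_id _)) // sub0r.
split=> [|n0 k ik].
  apply: (@derived_vanish_of_res _ _ _ _ _ B); first by exists (lin_id _), (lin_id _).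
  move=> j nj; apply: exact_of_cycles => [x|t dt]; first exact: res_dd.
  have [|c cE] := (@F_acyclic C j (leq0n j) (fmap G (phi j.+1) t)).1.
    rewrite -(fmap_comp G _ _ (lin_comp (phi j) (res_d B j))).
      by rewrite (fmap_comp G (res_d B j) (phi j)) // dt fmap0.
    by move=> x; rewrite linE phiS.
  by apply: (snd_bound _ _ c) => //; case: (n) nj.
have [_ augB] := fmap_rex G (res_exact0 B) (res_aug_surj B).
have [b bE] := augB k; have [exC _] := fmap_rex G (res_exact0 C) (res_aug_surj C).
have [|c cE] := (exC (fmap G (phi 0) b)).1.
  rewrite -(fmap_comp G _ _ (lin_comp i (res_aug B))).
    by rewrite (fmap_comp G (res_aug B) i) // bE.
  by move=> x; rewrite linE phi0.
have [||b' b'E] := snd_bound 0%N b c _ cE _; [by rewrite n0|by []|].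
by rewrite -bE -b'E; apply: fmap_complex; exact: res_aug_d.
Qed.

End DerivedShift.

(** * Restriction along a ring homomorphism *)

Section ChangeOfRings.
Variables (A B : pzRingType) (phi : {rmorphism A -> B}).
Implicit Types U V X Y Z P : lmodType B.

Lemma restr_lin_subproof U V (f : {linear U -> V}) :
  linear (f : restr phi U -> restr phi V).
Proof. by move=> a x y; exact: linearP. Qed.
Definition restr_lin U V (f : {linear U -> V}) :
    {linear restr phi U -> restr phi V} := mklin (restr_lin_subproof f).

Lemma retract_restr X Z : retract X Z -> retract (restr phi X) (restr phi Z).
Proof. by move=> [i [r irK]]; exists (restr_lin i), (restr_lin r). Qed.

Lemma restr_prod_subproof X Y :
  linear (fun x : restr phi (X * Y)%type => x : (restr phi X * restr phi Y)%type).
Proof. by []. Qed.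
Lemma restr_prod_inv_subproof X Y :
  linear (fun x : (restr phi X * restr phi Y)%type => x : restr phi (X * Y)%type).
Proof. by []. Qed.

Lemma retract_restr_prod X Y :
  retract (restr phi (X * Y)%type) (restr phi X * restr phi Y)%type.
Proof.
by exists (mklin (@restr_prod_subproof X Y)), (mklin (@restr_prod_inv_subproof X Y)).
Qed.

Lemma restr_short_exact (K F X : lmodType B) (i : {linear K -> F}) (p : {linear F -> X}) :
  short_exact i p -> short_exact (restr_lin i) (restr_lin p).
Proof. by []. Qed.

Variable G : rexfunctor A.
Variable nB : nat.
Hypothesis B_fgres : fgres_le nB (restr phi B^o).
Hypothesis B_acyclic : derived_vanish G 0 (restr phi B^o).

Lemma restr_fg_projective P : projective P -> finitely_generated P ->
  fgres_le nB (restr phi P) /\ derived_vanish G 0 (restr phi P).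
Proof.
apply: (fg_projective_ind (C := fun P => fgres_le nB (restr phi P) /\
  derived_vanish G 0 (restr phi P))) => [//|X Y [fgX X0] [fgY Y0]|X Z XZ [fgZ Z0]].
  have [[Q _] [Q' _]] := (fgX, fgY).
  split; first exact: fgres_le_retract (retract_restr_prod X Y) (fgres_le_prod fgX fgY).
  exact: derived_vanish_retract (prod_res Q Q') (retract_restr_prod X Y)
    (derived_vanish_prod Q Q' X0 Y0).
have [Q _] := fgZ; split; first exact: fgres_le_retract (retract_restr XZ) fgZ.
exact: derived_vanish_retract Q (retract_restr XZ) Z0.
Qed.

Lemma restr_fgres n X : fgres_le n X -> exists m, fgres_le m (restr phi X).
Proof.
move=> [P [Pn Pfg]]; elim: n X P Pn Pfg => [|n IHn] X P Pn Pfg; last first.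
  have [m fgm] := IHn _ (shift_res P) (shift_length Pn) (fun j => Pfg j.+1).
  have [fg0 _] := restr_fg_projective (res_projective P 0) (Pfg 0%N).
  by exists (maxn m.+1 nB); exact: fgres_le_cokernel (restr_short_exact (syz_exact P)) fgm fg0.
have [fg0 _] := restr_fg_projective (res_projective P 0) (Pfg 0%N); exists nB.
apply: fgres_le_retract fg0; apply: retract_restr.
have [s sE] : exists s : {linear X -> P 0%N}, forall x, s (res_aug P x) = lin_id _ x.
  apply: lin_factor => [|x /res_exact0[y <-]]; first exact: res_aug_surj.
  by rewrite (Pn 1%N isT y) !linear0.
by exists s, (res_aug P) => x; have [y <-] := res_aug_surj P x; rewrite sE.
Qed.

(** The derived functors of [G] can be computed from a [B]-projective resolution,
    since its terms are [G]-acyclic over [A]: dimension shifting along the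
    syzygies lowers the degree until it reaches the injectivity of
    [G K -> G (P 0)] for the first syzygy [K]. *)
Lemma exact_acyclic_resolution n m X (P : proj_resolution X) :
    res_length_le P m -> (forall j, finitely_generated (P j)) ->
    derived_vanish G n (restr phi X) ->
  forall j, (n <= j)%N ->
  exact_at (fmap G (restr_lin (res_d P j.+1))) (fmap G (restr_lin (res_d P j))).
Proof.
move=> Pm Pfg Xn j; elim: j n m X P Pm Pfg Xn => [|j IHj] n m X P Pm Pfg Xn nj.
all: have [[C0 [_ _]] F0] := restr_fg_projective (res_projective P 0) (Pfg 0%N).
all: have Km : res_length_le (shift_res P) m by move=> k mk; exact/Pm/ltnW.
all: have [k [B0 _]] : exists k, fgres_le k (restr phi (syz P))
  by apply: (@restr_fgres m); exists (shift_res P); split=> // k; exact: Pfg.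
all: have [Kn inj] := derived_vanish_shift B0 C0 (restr_short_exact (syz_exact P)) F0 Xn.
  apply: exact_of_cycles => [x|t dt]; first exact: res_dd.
  have [ex1 _] := fmap_rex G (f := restr_lin (res_d P 1)) (g := restr_lin (shift_aug P))
    (@shift_exact0 _ _ P) (@shift_aug_surj _ _ P).
  apply/ex1/inj; first by move: nj; rewrite leqn0 => /eqP.
  by rewrite -dt; apply: esym; apply: fmap_comp.
apply: (IHj n.-1 m _ (shift_res P)) => //.
  by move=> i; exact: Pfg.
by case: (n) nj.
Qed.

(** [X] is perfect over [A] as well, so its projective dimension over [A] is at
    most [n] and bounds the degrees in which [G P] can have homology. *)
Lemma exact_above_findim n m X (P : proj_resolution X) :
    (findim A <= Fin n)%enat ->
    res_length_le P m -> (forall j, finitely_generated (P j)) ->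
  forall j, (n <= j)%N ->
  exact_at (fmap G (restr_lin (res_d P j.+1))) (fmap G (restr_lin (res_d P j))).
Proof.
move=> /findim_leP nA Pm Pfg.
apply: (exact_acyclic_resolution Pm Pfg); apply: derived_vanish_pd; apply: nA.
by apply/fgresP; apply: (@restr_fgres m); exists P.
Qed.

End ChangeOfRings.

(** * Tensor products *)

Section TensorUniversal.
Variables (R : pzRingType) (N : lmodType R^c) (X : lmodType R).
Local Notation free := {freeg (N * X)%type / int}.

Lemma tens_pure0r (n : N) : tens_pure n (0 : X) = 0.
Proof. by apply: (addrI (tens_pure n 0)); rewrite -tens_pureDr !addr0. Qed.
Lemma tens_pure0l (x : X) : tens_pure (0 : N) x = 0.
Proof. by apply: (addrI (tens_pure 0 x)); rewrite -tens_pureDl !addr0. Qed.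
Lemma tens_pureNr (n : N) (x : X) : tens_pure n (- x) = - tens_pure n x.
Proof. by apply: (addrI (tens_pure n x)); rewrite -tens_pureDr !subrr tens_pure0r. Qed.

Lemma tens_ind (P : tens N X -> Prop) :
  P 0 -> (forall s t, P s -> P t -> P (s - t)) -> (forall n x, P (tens_pure n x)) ->
  forall t, P t.
Proof.
move=> P0 PB Ppure; elim/quotW => u.
have PN s : P s -> P (- s) by rewrite -sub0r; exact: PB.
have PD s t : P s -> P t -> P (s + t) by move=> Ps Pt; rewrite -[t]opprK; exact/PB/PN.
elim/freeg_ind_dom0: u => [|k [n x] u _ _ IHu]; first by rewrite raddf0.
rewrite raddfD; apply: (PD _ _ _ IHu).
have -> : << k *g (n, x) >> = tens_gen n x *~ k.
  by rewrite /tens_gen freegU_mulz intz.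
rewrite raddfMz; case: k => k /=.
  rewrite -pmulrn; elim: k => [|k IHk]; first by rewrite mulr0n.
  by rewrite mulrS; exact: (PD _ _ (Ppure n x) IHk).
rewrite NegzE mulrNz; apply: PN; rewrite -pmulrn.
elim: k => [|k IHk]; first by rewrite mulr1n; exact: (Ppure n x).
by rewrite mulrS; exact: (PD _ _ (Ppure n x) IHk).
Qed.

Section FreeLift.
Variables (Z : zmodType) (h : N * X -> Z).

Definition free_lift (u : free) : Z := fglift (h : N * X -> zmodule Z) u.

Lemma free_liftB u v : free_lift (u - v) = free_lift u - free_lift v.
Proof. exact: (lift_is_additive (h : N * X -> zmodule Z) u v). Qed.
Lemma free_lift0 : free_lift 0 = 0.
Proof. by rewrite -[0 in LHS](subrr 0) free_liftB subrr. Qed.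
Lemma free_liftD u v : free_lift (u + v) = free_lift u + free_lift v.
Proof. by rewrite -[v in LHS]opprK -[- v]sub0r !free_liftB free_lift0 sub0r opprK. Qed.
Lemma free_lift_gen n x : free_lift (tens_gen n x) = h (n, x).
Proof. by rewrite /free_lift /tens_gen liftU scale1r. Qed.

End FreeLift.

Section Lift.
Variables (Z : zmodType) (b : N -> X -> Z).
Hypothesis bDl : forall n n' x, b (n + n') x = b n x + b n' x.
Hypothesis bDr : forall n x x', b n (x + x') = b n x + b n x'.
Hypothesis bZ : forall (r : R) n x, b ((r : R^c) *: n) x = b n (r *: x).

Definition tens_lift (t : tens N X) : Z :=
  free_lift (fun nx => b nx.1 nx.2) (repr t).

Lemma tens_lift_rel u : tens_rel (M := N) (X := X) u ->
  free_lift (fun nx => b nx.1 nx.2) u = 0.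
Proof.
elim=> {u}.
- exact: free_lift0.
- by move=> u v _ hu _ hv; rewrite free_liftB hu hv subrr.
- by move=> n n' x; rewrite free_liftB free_liftD !free_lift_gen bDl subrr.
- by move=> n x x'; rewrite free_liftB free_liftD !free_lift_gen bDr subrr.
- by move=> r n x; rewrite free_liftB !free_lift_gen bZ subrr.
Qed.

Lemma tens_lift_pi u : tens_lift (\pi_(tens N X)%qT u) = free_lift (fun nx => b nx.1 nx.2) u.
Proof.
apply/eqP; rewrite -subr_eq0 -free_liftB; apply/eqP; apply: tens_lift_rel.
by apply/tens_eq; exact: reprK.
Qed.

Lemma tens_lift_pure n x : tens_lift (tens_pure n x) = b n x.
Proof. by rewrite tens_lift_pi free_lift_gen. Qed.

Lemma tens_liftD s t : tens_lift (s + t) = tens_lift s + tens_lift t.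
Proof.
elim/quotW: s => u; elim/quotW: t => v.
by rewrite -[X in tens_lift X]raddfD !tens_lift_pi free_liftD.
Qed.
End Lift.

Lemma tens_eq_pure (Z : zmodType) (f g : tens N X -> Z) :
    (forall s t, f (s + t) = f s + f t) -> (forall s t, g (s + t) = g s + g t) ->
    (forall n x, f (tens_pure n x) = g (tens_pure n x)) ->
  forall t, f t = g t.
Proof.
move=> fD gD fg.
have f0 : f 0 = 0 by apply: (addrI (f 0)); rewrite -fD !addr0.
have g0 : g 0 = 0 by apply: (addrI (g 0)); rewrite -gD !addr0.
have fN s : f (- s) = - f s by apply: (addrI (f s)); rewrite -fD !subrr.
have gN s : g (- s) = - g s by apply: (addrI (g s)); rewrite -gD !subrr.
by elim/tens_ind=> [|s t fs ft|//]; rewrite ?f0 ?g0 // fD gD fN gN fs ft.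
Qed.

End TensorUniversal.

Section TensorFunctor.
Variables (R : pzRingType) (N : lmodType R^c).
Implicit Types U V W : lmodType R.

Lemma tens_map_id U (f : {linear U -> U}) : (forall x, f x = x) ->
  forall t : tens N U, tens_map f t = t.
Proof.
move=> f_id; apply: tens_eq_pure => [||n x] //; first exact: tens_mapD.
by rewrite tens_map_pure f_id.
Qed.

Lemma tens_map_comp U V W (f : {linear U -> V}) (g : {linear V -> W})
    (h : {linear U -> W}) : (forall x, h x = g (f x)) ->
  forall t : tens N U, tens_map h t = tens_map g (tens_map f t).
Proof.
move=> hE; apply: tens_eq_pure => [||n x]; first exact: tens_mapD.
  by move=> s t; rewrite !tens_mapD.
by rewrite !tens_map_pure hE.
Qed.

Lemma tens_map_add U V (f g h : {linear U -> V}) : (forall x, h x = f x + g x) ->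
  forall t : tens N U, tens_map h t = tens_map f t + tens_map g t.
Proof.
move=> hE; apply: tens_eq_pure => [||n x]; first exact: tens_mapD.
  by move=> s t; rewrite !tens_mapD addrACA.
by rewrite !tens_map_pure hE tens_pureDr.
Qed.

Lemma tens_map0 U V (f : {linear U -> V}) : tens_map f (0 : tens N U) = 0.
Proof. by apply: (addrI (tens_map f 0)); rewrite -tens_mapD !addr0. Qed.
Lemma tens_mapB U V (f : {linear U -> V}) (s t : tens N U) :
  tens_map f (s - t) = tens_map f s - tens_map f t.
Proof. by apply: (addIr (tens_map f t)); rewrite -tens_mapD !subrK. Qed.

Lemma tens_map_surj U V (f : {linear U -> V}) : surj f -> surj (tens_map (M := N) f).
Proof.
move=> f_surj; elim/tens_ind=> [|s t [s' <-] [t' <-]|n x].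
- by exists 0; exact: tens_map0.
- by exists (s' - t'); exact: tens_mapB.
- by have [y <-] := f_surj x; exists (tens_pure n y); exact: tens_map_pure.
Qed.

(** Given a set-theoretic section [s] of [g], the map [n (x) w |-> n (x) s w] is
    well defined on the free group only; it sends the relations of [N (x) W] into
    the image of [N (x) U], and it inverts [N (x) g] modulo that image. *)
Lemma tens_map_rex U V W (f : {linear U -> V}) (g : {linear V -> W}) :
    exact_at f g -> surj g ->
  exact_at (tens_map (M := N) f) (tens_map g) /\ surj (tens_map (M := N) g).
Proof.
move=> ex_fg g_surj; split; last exact: tens_map_surj.
pose im (t : tens N V) := exists s, tens_map f s = t.
have imB s t : im s -> im t -> im (s - t).
  by move=> [s' <-] [t' <-]; exists (s' - t'); exact: tens_mapB.
have im0 : im 0 by exists 0; exact: tens_map0.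
have im_pure n v : g v = 0 -> im (tens_pure n v).
  by move=> /ex_fg[u <-]; exists (tens_pure n u); exact: tens_map_pure.
pose s w := sval (cid (g_surj w)).
have sK w : g (s w) = w by rewrite /s; case: cid.
pose th := @free_lift _ N W (tens N V) (fun nw => tens_pure nw.1 (s nw.2)).
have th_gen n w : th (tens_gen n w) = tens_pure n (s w) by exact: free_lift_gen.
have thB u v : th (u - v) = th u - th v by exact: free_liftB.
have thD u v : th (u + v) = th u + th v by exact: free_liftD.
have th_rel u : tens_rel u -> im (th u).
  elim=> {u}.
  - by rewrite /th free_lift0.
  - by move=> u v _ imu _ imv; rewrite thB; exact: imB.
  - by move=> n n' w; rewrite thB thD !th_gen tens_pureDl subrr.
  - move=> n w w'; rewrite thB thD !th_gen -tens_pureDr -tens_pureNr -tens_pureDr.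
    by apply: im_pure; rewrite linearB linearD /= !sK subrr.
  - move=> r n w; rewrite thB !th_gen tens_pureZ -tens_pureNr -tens_pureDr.
    by apply: im_pure; rewrite linearB linearZ /= !sK subrr.
have th_inv t : exists u, \pi_(tens N W)%qT u = tens_map g t /\ im (t - th u).
  elim/tens_ind: t => [|t t' [u [uE imu]] [u' [u'E imu']]|n v].
  - by exists 0; rewrite raddf0 tens_map0 /th free_lift0 subrr.
  - exists (u - u'); rewrite raddfB /= uE u'E tens_mapB; split=> //.
    suff -> : t - t' - th (u - u') = t - th u - (t' - th u') by exact: imB.
    by rewrite thB !opprB addrACA [in RHS]addrACA [- t' + _]addrC.
  - exists (tens_gen n (g v)); rewrite tens_map_pure; split=> //.
    rewrite th_gen -tens_pureNr -tens_pureDr.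
    by apply: im_pure; rewrite linearB /= sK subrr.
move=> t; split=> [gt0|[s' <-]]; last first.
  elim/tens_ind: s' => [|s1 s2 IH1 IH2|n x]; rewrite ?tens_map0 //.
    by rewrite !tens_mapB IH1 IH2 subrr.
  by rewrite !tens_map_pure (_ : g (f x) = 0) ?tens_pure0r //; apply/ex_fg; exists x.
have [u [uE imu]] := th_inv t.
have imth : im (th u).
  by apply: th_rel; rewrite -[u]subr0; apply/tens_eq; rewrite uE gt0 raddf0.
have im_opp v : im v -> im (- v) by rewrite -sub0r; exact: imB.
by have := imB _ _ imu (im_opp _ imth); rewrite opprK subrK.
Qed.

Definition tens_functor : rexfunctor R :=
  @RexFunctor R (fun X => tens N X) (fun U V f t => tens_map f t)
    (fun U V f s t => tens_mapD f s t) tens_map_id tens_map_comp tens_map_add tens_map_rex.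

End TensorFunctor.

Section BimodTensor.
Variables (B A : pzRingType) (M : bimodType B A) (X : lmodType A).

Definition btens : Type := tens (bimod_right M) X.
HB.instance Definition _ := GRing.Zmodule.on btens.

Let act b (m : bimod_right M) (x : X) : btens :=
  tens_pure ((b *: (m : M)) : bimod_right M) x.
Let actDl b m m' x : act b (m + m') x = act b m x + act b m' x.
Proof. by rewrite /act -tens_pureDl; congr tens_pure; exact: (scalerDr b (m : M)). Qed.
Let actDr b m x x' : act b m (x + x') = act b m x + act b m x'.
Proof. exact: tens_pureDr. Qed.
Let actZ b (r : A) m x : act b ((r : A^c) *: m) x = act b m (r *: x).
Proof. by rewrite /act -tens_pureZ; congr tens_pure; exact: rscaleAl. Qed.

Definition btens_scale (b : B) (t : btens) : btens := tens_lift (act b) t.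

Lemma btens_scale_pure b (m : M) x :
  btens_scale b (tens_pure (m : bimod_right M) x)
  = tens_pure ((b *: m) : bimod_right M) x.
Proof. by rewrite /btens_scale tens_lift_pure. Qed.

Fact btens_scaleDr : right_distributive btens_scale +%R.
Proof. by move=> b s t; rewrite /btens_scale tens_liftD. Qed.
Fact btens_scaleDl t : {morph btens_scale^~ t : a b / a + b}.
Proof.
move=> a b; move: t; apply: tens_eq_pure => [s t|s t|m x]; first exact: btens_scaleDr.
  by rewrite !btens_scaleDr addrACA.
by rewrite !btens_scale_pure scalerDl -tens_pureDl.
Qed.
Fact btens_scaleA a b t : btens_scale a (btens_scale b t) = btens_scale (a * b) t.
Proof.
move: t; apply: tens_eq_pure => [s t|s t|m x]; first by rewrite !btens_scaleDr.
  exact: btens_scaleDr.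
by rewrite !btens_scale_pure scalerA.
Qed.
Fact btens_scale1 : left_id 1 btens_scale.
Proof.
apply: tens_eq_pure => [s t|//|m x]; first exact: btens_scaleDr.
by rewrite btens_scale_pure scale1r.
Qed.

HB.instance Definition _ := GRing.Zmodule_isLmodule.Build B btens
  btens_scaleA btens_scale1 btens_scaleDr btens_scaleDl.

End BimodTensor.

(** * Modules over a trivial extension *)

Section TrivextRing.
Variables (A : pzRingType) (M : bimodType A A).
Local Notation T := (trivext M).

Lemma rscale0 (m : M) : rscale m (0 : A) = 0.
Proof. by apply: (addrI (rscale m 0)); rewrite -rscaleDr !addr0. Qed.
Lemma rscale0m (a : A) : rscale (0 : M) a = 0.
Proof. by apply: (addrI (rscale 0 a)); rewrite -rscaleDl !addr0. Qed.

Definition tin (a : A) : T := (a, 0).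
Definition teps (m : M) : T := (0, m).
Definition tfst (t : T) : A := t.1.

Fact tin_zmod : zmod_morphism tin.
Proof. by move=> a b; congr pair; rewrite /= subr0. Qed.
Fact tin_monoid : monoid_morphism tin.
Proof.
by split=> // a b; congr pair; rewrite /= scaler0 rscale0m addr0.
Qed.
HB.instance Definition _ := GRing.isZmodMorphism.Build A T tin tin_zmod.
HB.instance Definition _ := GRing.isMonoidMorphism.Build A T tin tin_monoid.

Fact tfst_zmod : zmod_morphism tfst. Proof. by []. Qed.
Fact tfst_monoid : monoid_morphism tfst. Proof. by []. Qed.
HB.instance Definition _ := GRing.isZmodMorphism.Build T A tfst tfst_zmod.
HB.instance Definition _ := GRing.isMonoidMorphism.Build T A tfst tfst_monoid.

Lemma tmulE (x y : T) : x * y = (x.1 * y.1, x.1 *: y.2 + rscale x.2 y.1) :> T.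
Proof. by []. Qed.

Lemma tpairE (t : T) : t = tin t.1 + teps t.2.
Proof. by case: t => a m; congr pair; rewrite /= ?addr0 ?add0r. Qed.
Lemma tepsD m n : teps (m + n) = teps m + teps n.
Proof. by congr pair; rewrite /= addr0. Qed.
Lemma teps_mul m n : teps m * teps n = 0.
Proof. by congr pair; rewrite /= ?mul0r ?scale0r ?rscale0 ?addr0. Qed.
Lemma tin_teps a m : tin a * teps m = teps (a *: m).
Proof. by congr pair; rewrite /= ?mulr0 ?rscale0 ?addr0. Qed.
Lemma teps_tin m a : teps m * tin a = teps (rscale m a).
Proof. by congr pair; rewrite /= ?mul0r ?scaler0 ?add0r. Qed.
Lemma t_teps (t : T) m : t * teps m = teps (t.1 *: m).
Proof. by rewrite [in LHS](tpairE t) mulrDl teps_mul addr0 tin_teps. Qed.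

End TrivextRing.

Section Trivext.
Variables (A : pzRingType) (M : bimodType A A).
Local Notation T := (trivext M).
Local Notation tin := (@tin A M).
Local Notation teps := (@teps A M).
Local Notation tfst := (@tfst A M).

(** ** Induced modules *)

Section Ind.
Variable X : lmodType A.

Definition mpure (m : M) (x : X) : btens M X := tens_pure (m : bimod_right M) x.
Lemma mpureZ a m x : a *: mpure m x = mpure (a *: m) x.
Proof. exact: btens_scale_pure. Qed.
Lemma mpure_rscale (a : A) m x : mpure (rscale m a) x = mpure m (a *: x).
Proof. exact: tens_pureZ. Qed.
Lemma mpureDl m n x : mpure (m + n) x = mpure m x + mpure n x.
Proof. exact: tens_pureDl. Qed.
Lemma mpureDr m x y : mpure m (x + y) = mpure m x + mpure m y.
Proof. exact: tens_pureDr. Qed.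
Lemma mpure0l x : mpure 0 x = 0.
Proof. by apply: (addrI (mpure 0 x)); rewrite -mpureDl !addr0. Qed.
Lemma mpure0r m : mpure m 0 = 0.
Proof. by apply: (addrI (mpure m 0)); rewrite -mpureDr !addr0. Qed.

(** This is the extension of scalars [T (x)_A X], as [T] is the direct sum of [A]
    and [M] as a right [A]-module. *)
Definition ind : Type := (X * btens M X)%type.
HB.instance Definition _ := GRing.Zmodule.copy ind (X * btens M X)%type.

Let scale (t : T) (u : ind) : ind := (t.1 *: u.1, mpure t.2 u.1 + t.1 *: u.2).

Fact ind_scaleA s t u : scale s (scale t u) = scale (s * t) u.
Proof.
congr pair; rewrite /= ?scalerA // scalerDr mpureZ mpureDl mpure_rscale scalerA addrA.
by congr (_ + _); rewrite addrC.
Qed.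
Fact ind_scale1 : left_id 1 scale.
Proof. by move=> [x u]; congr pair; rewrite /= ?scale1r // mpure0l add0r. Qed.
Fact ind_scaleDr : right_distributive scale +%R.
Proof.
by move=> t u v; congr pair; rewrite /= scalerDr // mpureDr addrACA.
Qed.
Fact ind_scaleDl u : {morph scale^~ u : s t / s + t}.
Proof.
by move=> s t; congr pair; rewrite /= scalerDl // mpureDl addrACA.
Qed.
HB.instance Definition _ := GRing.Zmodule_isLmodule.Build T ind
  ind_scaleA ind_scale1 ind_scaleDr ind_scaleDl.

Lemma ind_scaleE (t : T) (u : ind) :
  t *: u = (t.1 *: u.1, mpure t.2 u.1 + t.1 *: u.2) :> ind.
Proof. by []. Qed.

Lemma ind_unit_subproof : linear (fun x : X => (x, 0) : restr tin ind).
Proof.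
apply: linear_of_addZ => [x y|a x]; congr pair; rewrite /= ?addr0 //.
by rewrite mpure0l scaler0 addr0.
Qed.
Definition ind_unit : {linear X -> restr tin ind} := mklin ind_unit_subproof.

Lemma ind_eps (m : M) x : teps m *: ((x, 0) : ind) = (0, mpure m x) :> ind.
Proof. by rewrite ind_scaleE /= !scale0r addr0. Qed.

Section IndLift.
Variables (Y : lmodType T) (f : {linear X -> restr tin Y}).

Let b (m : bimod_right M) (x : X) : Y := teps m *: (f x : Y).
Let bDl m m' x : b (m + m') x = b m x + b m' x.
Proof. by rewrite /b -scalerDl -tepsD. Qed.
Let bDr m x y : b m (x + y) = b m x + b m y.
Proof. by rewrite /b linearD; exact: (scalerDr (teps m) (f x : Y)). Qed.
Let bZ (a : A) m x : b ((a : A^c) *: m) x = b m (a *: x).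
Proof. by rewrite /b linearZ [RHS](scalerA (teps m) (tin a) (f x : Y)) teps_tin. Qed.

Definition ind_lift_fun (u : ind) : Y := (f u.1 : Y) + tens_lift b u.2.

Lemma ind_lift_subproof : linear ind_lift_fun.
Proof.
have lD s t : tens_lift b (s + t) = tens_lift b s + tens_lift b t by exact: tens_liftD.
have lE m x : tens_lift b (mpure m x) = teps m *: (f x : Y) by exact: tens_lift_pure.
have l0 : tens_lift b 0 = 0 by apply: (addrI (tens_lift b 0)); rewrite -lD !addr0.
have lZ a (t : btens M X) : tens_lift b (a *: t) = tin a *: tens_lift b t.
  move: t; apply: tens_eq_pure => [s t|s t|m x].
  - by rewrite -lD; congr (tens_lift b _); exact: (scalerDr a (s : btens M X) t).
  - by rewrite lD scalerDr.
  - by rewrite [X in tens_lift b X](mpureZ a m x) lE (lE m x) scalerA tin_teps.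
have leps m (t : btens M X) : teps m *: tens_lift b t = 0.
  move: t; apply: tens_eq_pure => [s t|s t|n x]; first by rewrite lD scalerDr.
    by rewrite addr0.
  by rewrite (lE n x) scalerA teps_mul scale0r.
apply: linear_of_addZ => [u v|t u]; rewrite /ind_lift_fun /=.
  by rewrite linearD lD addrACA.
have fZ : f (t.1 *: u.1) = tin t.1 *: (f u.1 : Y) by rewrite linearZ.
have tY (y : Y) : t *: y = tin t.1 *: y + teps t.2 *: y by rewrite -scalerDl -tpairE.
by rewrite [f _]fZ lD lE lZ scalerDr !tY leps addr0 addrA.
Qed.

Lemma ind_lift_ex : exists g : {linear ind -> Y},
  forall x m y, g (x, mpure m y) = (f x : Y) + teps m *: (f y : Y).
Proof.
exists (mklin ind_lift_subproof) => x m y.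
by rewrite mklinE /ind_lift_fun /= [tens_lift _ _]tens_lift_pure.
Qed.
Definition ind_lift : {linear ind -> Y} := sval (cid ind_lift_ex).

Lemma ind_liftE x m y : ind_lift (x, mpure m y) = (f x : Y) + teps m *: (f y : Y).
Proof. exact: svalP (cid ind_lift_ex) x m y. Qed.

Lemma ind_lift_unit x : ind_lift (ind_unit x) = f x.
Proof.
have -> : ind_unit x = (x, mpure 0 0) :> ind by congr pair; rewrite mpure0l.
by rewrite ind_liftE linear0 scaler0 addr0.
Qed.

End IndLift.

Lemma ind_eq (Y : lmodType T) (f g : {linear ind -> Y}) :
  (forall x, f (ind_unit x) = g (ind_unit x)) -> forall u, f u = g u.
Proof.
move=> fg [x t].
have split_u : (x, t) = (x, 0) + (0, t) :> ind by congr pair; rewrite /= ?addr0 ?add0r.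
rewrite split_u !linearD; congr (_ + _); first exact: fg.
move: t {split_u}; apply: (tens_eq_pure (f := fun t => f (0, t)) (g := fun t => g (0, t))).
- by move=> s t; rewrite -linearD; congr (f _); congr pair; rewrite /= addr0.
- by move=> s t; rewrite -linearD; congr (g _); congr pair; rewrite /= addr0.
- move=> m y; have := congr1 (GRing.scale (teps m)) (fg y).
  by rewrite -!linearZ /= [teps m *: _]ind_eps.
Qed.

(** Linear maps from [ind] to [Y] are the [A]-linear maps from [X] to the
    restriction of [Y]. *)
Lemma projective_ind : projective X -> projective (ind : lmodType T).
Proof.
move=> Xproj Y Z g f g_surj.
have f_lin : linear (fun x => f (ind_unit x) : restr tin Z).
  move=> a x y; rewrite linearP; exact: (linearP f (tin a) (ind_unit x : ind) _).
have [k kE] := Xproj _ _ (restr_lin tin g) (mklin f_lin) g_surj.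
exists (ind_lift k); apply: (ind_eq (f := lin_comp g (ind_lift k))) => x.
by rewrite linE ind_lift_unit; exact: kE.
Qed.

Lemma fg_ind : finitely_generated X -> finitely_generated (ind : lmodType T).
Proof.
move=> [n [g gP]]; exists n, (fun i => (g i, 0)) => -[x t].
suff [c cE] : exists c : 'I_n -> M, t = \sum_(i < n) mpure (c i) (g i).
  have [d dE] := gP x; exists (fun i => (d i, c i)).
  rewrite (eq_bigr (fun i => (d i *: g i, mpure (c i) (g i)) : ind)); last first.
    by move=> i _; rewrite ind_scaleE /= scaler0 addr0.
  have fstE := raddf_sum (lin_fst X (btens M X)) (index_enum 'I_n) xpredT.
  have sndE := raddf_sum (lin_snd X (btens M X)) (index_enum 'I_n) xpredT.
  rewrite [RHS]surjective_pairing; congr pair.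
    by rewrite dE [RHS]fstE.
  by rewrite cE [RHS]sndE.
elim/tens_ind: t => [|s t [c cE] [d dE]|m y].
- by exists (fun=> 0); rewrite big1 // => i _; rewrite mpure0l.
- exists (fun i => c i - d i); rewrite cE dE -sumrB; apply: eq_bigr => i _.
  by apply/eqP; rewrite subr_eq -mpureDl subrK.
- have [c ->] := gP y; exists (fun i => rscale m (c i)).
  rewrite [LHS](_ : _ = mpure m (\sum_(i < n) c i *: g i)) //.
  elim/big_rec2: _ => [|i s t _ <-]; first exact: mpure0r.
  by rewrite mpureDr mpure_rscale.
Qed.

End Ind.

Definition btens_map (X Y : lmodType A) (f : {linear X -> Y}) (t : btens M X) : btens M Y :=
  tens_map f t.
Lemma btens_mapD (X Y : lmodType A) (f : {linear X -> Y}) s t :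
  btens_map f (s + t) = btens_map f s + btens_map f t.
Proof. exact: tens_mapD. Qed.
Lemma btens_map_pure (X Y : lmodType A) (f : {linear X -> Y}) m x :
  btens_map f (mpure m x) = mpure m (f x).
Proof. exact: tens_map_pure. Qed.
Lemma btens_mapZ (X Y : lmodType A) (f : {linear X -> Y}) a t :
  btens_map f (a *: t) = a *: btens_map f t.
Proof.
move: t; apply: tens_eq_pure => [s t|s t|m x].
- rewrite -btens_mapD; congr (btens_map f _); exact: (scalerDr a (s : btens M X) t).
- by rewrite btens_mapD scalerDr.
- by rewrite [X in btens_map f X](mpureZ a m x) !btens_map_pure mpureZ.
Qed.

Lemma ind_map_subproof (X Y : lmodType A) (f : {linear X -> Y}) :
  linear (fun u : ind X => (f u.1, btens_map f u.2) : ind Y).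
Proof.
apply: linear_of_addZ => [u v|t u].
  by congr pair; rewrite /= ?linearD ?btens_mapD.
by congr pair; rewrite /= ?linearZ // btens_mapD btens_map_pure btens_mapZ.
Qed.
Definition ind_map (X Y : lmodType A) (f : {linear X -> Y}) : {linear ind X -> ind Y} :=
  mklin (ind_map_subproof f).
Lemma ind_mapE (X Y : lmodType A) (f : {linear X -> Y}) x t :
  ind_map f (x, t) = (f x, btens_map f t).
Proof. by []. Qed.

Lemma exact_ind_map (X Y Z : lmodType A) (f : {linear X -> Y}) (g : {linear Y -> Z}) :
  exact_at f g -> exact_at (btens_map f) (btens_map g) -> exact_at (ind_map f) (ind_map g).
Proof.
move=> ex ex' [y t]; rewrite ind_mapE; split=> [[gy gt]|[[x s]]].
  have [x xE] := (ex y).1 gy; have [s sE] := (ex' t).1 gt.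
  by exists (x, s); rewrite ind_mapE xE sE.
rewrite ind_mapE => -[xE sE]; congr pair; first by apply/ex; exists x.
by apply/ex'; exists s.
Qed.

(** ** Reduction modulo the square-zero ideal *)

Section Red.
Variable X : lmodType T.

(** The submodule [M X], for [M] the square-zero ideal of [T]. *)
Inductive eps_span : X -> Prop :=
| eps_span0 : eps_span 0
| eps_spanD x y : eps_span x -> eps_span y -> eps_span (x + y)
| eps_span_gen m x : eps_span (teps m *: x).

Lemma eps_spanZ t x : eps_span x -> eps_span (t *: x).
Proof.
elim=> [|y z _ IHy _ IHz|m y]; first by rewrite scaler0; exact: eps_span0.
  by rewrite scalerDr; exact: eps_spanD.
by rewrite scalerA t_teps; exact: eps_span_gen.
Qed.

Lemma eps_eps_span m x : eps_span x -> teps m *: x = 0.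
Proof.
elim=> [|y z _ IHy _ IHz|n y]; first exact: scaler0.
  by rewrite scalerDr IHy IHz addr0.
by rewrite scalerA teps_mul scale0r.
Qed.

Definition eps_submod : submod X := Submod eps_span0 eps_spanD eps_spanZ.

(** [T] acts on [X / M X] through its quotient [A], and restriction along the
    section [tin] recovers that action of [A]. *)
Definition red : Type := restr tin (quotmod eps_submod).
HB.instance Definition _ := GRing.Lmodule.on red.

Definition red_proj : {linear X -> quotmod eps_submod} := quot_proj eps_submod.
Lemma red_proj0 x : red_proj x = 0 <-> eps_span x. Proof. exact: quot_proj0. Qed.
Lemma red_proj_surj : surj red_proj. Proof. exact: quot_proj_surj. Qed.

Lemma red_proj_lin_subproof : linear (red_proj : X -> restr tfst red).
Proof.
apply: linear_of_addZ => [x y|t x]; first exact: linearD.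
rewrite linearZ /= [t in LHS]tpairE scalerDl -[teps _ *: _]linearZ /=.
rewrite (_ : red_proj (teps t.2 *: x) = 0) ?addr0 //.
by apply/red_proj0; exact: eps_span_gen.
Qed.
Definition red_proj_lin : {linear X -> restr tfst red} := mklin red_proj_lin_subproof.

End Red.

Lemma eps_span_map (X Y : lmodType T) (f : {linear X -> Y}) x :
  eps_span x -> eps_span (f x).
Proof.
elim=> [|y z _ IHy _ IHz|m y]; first by rewrite linear0; exact: eps_span0.
  by rewrite linearD; exact: eps_spanD.
by rewrite linearZ; exact: eps_span_gen.
Qed.

(** [red P] is projective over [A], as maps from it to an [A]-module are the
    maps from [P] to the inflation of that module. *)
Lemma projective_red (P : lmodType T) : projective P -> projective (red P).
Proof.
move=> Pproj Y Z g f g_surj.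
have f_lin : linear ((fun x => f (red_proj P x)) : P -> restr tfst Z).
  apply: linear_of_addZ => [x y|t x]; first by rewrite !linearD.
  have fZ a (y : red P) : f (a *: y) = a *: f y by rewrite linearZ.
  apply: etrans (fZ t.1 (red_proj P x)); congr (f _).
  have pZ : red_proj_lin P (t *: x) = t *: red_proj_lin P x by rewrite linearZ.
  exact: pZ.
have [k kE] := Pproj _ _ (restr_lin tfst g) (mklin f_lin) g_surj.
have k0 x : red_proj P x = 0 -> k x = 0.
  move/red_proj0; elim=> [|y z _ IHy _ IHz|m y]; first exact: linear0.
    by rewrite linearD IHy IHz addr0.
  by rewrite linearZ; exact: (scale0r (k y : Y)).
have [h hE] := lin_factor (@red_proj_surj P) k0.
have h_lin : linear (h : red P -> Y).
  apply: linear_of_addZ => [x y|a x]; first exact: linearD.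
  have hZ : h (tin a *: (x : quotmod (eps_submod P))) = tin a *: h x by rewrite linearZ.
  exact: hZ.
exists (mklin h_lin) => x; have [y <-] := red_proj_surj (x : quotmod (eps_submod P)).
by rewrite mklinE hE; exact: kE.
Qed.

Lemma fg_red (P : lmodType T) : finitely_generated P -> finitely_generated (red P).
Proof.
move=> [n [g gP]]; exists n, (fun i => red_proj P (g i)) => x.
have [y <-] := red_proj_surj (x : quotmod (eps_submod P)).
have [c ->] := gP y; exists (fun i => (c i).1).
have sumE := raddf_sum (red_proj_lin P) (index_enum 'I_n) xpredT.
rewrite [LHS]sumE; apply: eq_bigr => i _.
have pZ : red_proj_lin P (c i *: g i) = c i *: red_proj_lin P (g i) by rewrite linearZ.
exact: pZ.
Qed.

Section RedMap.
Variables (X Y : lmodType T) (f : {linear X -> Y}).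

Lemma red_map_ex : exists g : {linear quotmod (eps_submod X) -> quotmod (eps_submod Y)},
  forall x, g (red_proj X x) = lin_comp (red_proj Y) f x.
Proof.
apply: lin_factor => [|x /red_proj0 xM]; first exact: red_proj_surj.
exact/red_proj0/eps_span_map.
Qed.
Definition red_map := sval (cid red_map_ex).
Lemma red_mapE x : red_map (red_proj X x) = red_proj Y (f x).
Proof. exact: svalP (cid red_map_ex) x. Qed.

Definition red_lin : {linear red X -> red Y} := restr_lin tin red_map.

End RedMap.

Lemma red_ind (X : lmodType T) (P : quotmod (eps_submod X) -> Prop) :
  (forall x, P (red_proj X x)) -> forall y, P y.
Proof. by move=> Pp y; have [x <-] := red_proj_surj y. Qed.

Lemma red_map_exactP (X Y Z : lmodType T) (f : {linear X -> Y}) (g : {linear Y -> Z}) :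
    (forall x, g (f x) = 0) ->
  exact_at (red_map f) (red_map g) <->
  forall y, eps_span (g y) -> exists x, eps_span (y - f x).
Proof.
move=> gf0; split=> [ex y /red_proj0|cyc].
  rewrite -red_mapE => /ex[]; apply: red_ind => x; rewrite red_mapE => fx.
  by exists x; apply/red_proj0; rewrite linearB /= fx subrr.
apply: red_ind => y; rewrite red_mapE red_proj0; split=> [/cyc[x]|[]].
  move/red_proj0; rewrite linearB /= => /eqP; rewrite subr_eq0 => /eqP ->.
  by exists (red_proj X x); rewrite red_mapE.
apply: red_ind => x; rewrite red_mapE => /esym/eqP.
rewrite -subr_eq0 -linearB => /eqP/red_proj0/(eps_span_map g).
by rewrite linearB /= gf0 subr0.
Qed.

Definition red_functor : rexfunctor T.
Proof.
refine (@RexFunctor T (fun X => quotmod (eps_submod X)) (fun U V f t => red_map f t)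
  _ _ _ _ _).
- by move=> U V f s t; rewrite linearD.
- by move=> U f f_id; apply: red_ind => x; rewrite red_mapE f_id.
- by move=> U V W f g h hE; apply: red_ind => x; rewrite !red_mapE hE.
- by move=> U V f g h hE; apply: red_ind => x; rewrite !red_mapE hE linearD.
move=> U V W f g ex g_surj; split; last first.
  by apply: red_ind => w; have [v <-] := g_surj w; exists (red_proj V v); rewrite red_mapE.
apply/red_map_exactP => [x|v]; first by apply/ex; exists x.
have lift_eps w : eps_span w -> exists v', eps_span v' /\ g v' = w.
  elim=> [|x y _ [x' [x'M <-]] _ [y' [y'M <-]]|m x].
  - by exists 0; split; [exact: eps_span0|exact: linear0].
  - by exists (x' + y'); split; [exact: eps_spanD|exact: linearD].
  - have [x' <-] := g_surj x; exists (teps m *: x').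
    by split; [exact: eps_span_gen|rewrite linearZ].
move=> /lift_eps[v' [v'M gv']].
have /ex[u uE] : g (v - v') = 0 by rewrite linearB /= gv' subrr.
by exists u; rewrite uE opprB addrC subrK.
Defined.

(** Lift [h0] and [h1] to [H0] and [H1], and put [u = d1 H1 + H0 d0]. Then
    [e = u - 1] takes values in [M P1] and is linear, so it kills [M P1]; hence
    [e e = 0] and [1 - e] inverts [u]. With [k = (1 - e) H0], and
    [H0 d0 = u - d1 H1], the difference of [d0] and [d0 k d0] is
    [d0 (1 - e) d1 H1], which is zero because [d0 u d1 = d0 d1 H1 d1 = 0]. *)
Lemma lift_contraction (P0 P1 P2 : lmodType T)
    (d0 : {linear P1 -> P0}) (d1 : {linear P2 -> P1})
    (h0 : {linear red P0 -> red P1}) (h1 : {linear red P1 -> red P2}) :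
    projective P0 -> projective P1 -> (forall x, d0 (d1 x) = 0) ->
    (forall x, x = red_lin d1 (h1 x) + h0 (red_lin d0 x)) ->
  exists k : {linear P0 -> P1}, forall x, d0 (k (d0 x)) = d0 x.
Proof.
move=> P0proj P1proj dd hE.
have red_lift (P Q : lmodType T) (h : {linear red P -> red Q}) : projective P ->
    exists H : {linear P -> Q}, forall x, red_proj Q (H x) = h (red_proj P x).
  move=> Pproj; have a_lin : linear ((fun x => h (red_proj_lin P x)) : P -> restr tfst (red Q)).
    apply: linear_of_addZ => [x y|t x]; first by rewrite !linearD.
    have hZ a (y : red P) : h (a *: y) = a *: h y by rewrite linearZ.
    by rewrite linearZ; exact: (hZ t.1).
  exact: (proj_lift (f := red_proj_lin Q) (a := mklin a_lin) Pproj
    (fun p => red_proj_surj (h (red_proj P p) : quotmod (eps_submod Q)))).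
have [H0 H0E] := red_lift _ _ h0 P0proj.
have [H1 H1E] := red_lift _ _ h1 P1proj.
pose u : {linear P1 -> P1} := lin_add (lin_comp d1 H1) (lin_comp H0 d0).
pose e : {linear P1 -> P1} := lin_sub u (lin_id _).
have eM x : eps_span (e x).
  apply/red_proj0; rewrite /e /u !linE linearB linearD /= H0E.
  rewrite -2!red_mapE H1E; apply/eqP; rewrite subr_eq0; apply/eqP.
  exact: esym (hE (red_proj _ x)).
have eM0 x : eps_span x -> e x = 0.
  elim=> [|y z _ IHy _ IHz|m y]; first exact: linear0.
    by rewrite linearD IHy IHz addr0.
  by rewrite linearZ; exact/eps_eps_span/eM.
have ee x : e (e x) = 0 by exact/eM0/eM.
have uE x : u x = x + e x by rewrite /e lin_subE lin_idE addrC subrK.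
exists (lin_comp (lin_sub (lin_id _) e) H0) => x.
have H0d : H0 (d0 x) = x + e x - d1 (H1 x).
  by rewrite -uE /u !linE [_ + H0 _]addrC addrK.
have d0ed1 y : d0 (e (d1 y)) = 0.
  have d0u : d0 (u (d1 y)) = 0 by rewrite /u !linE dd linear0 addr0 dd.
  by rewrite /e lin_subE linearB /= d0u lin_idE dd subrr.
have eH0d : e (H0 (d0 x)) = e x - e (d1 (H1 x)).
  by rewrite H0d linearB linearD ee addr0.
rewrite lin_compE lin_subE lin_idE; clearbody e.
by rewrite eH0d H0d !linearB linearD /= d0ed1 dd !subr0 oppr0 subr0 addrK.
Qed.

End Trivext.

(** * Tensor products along a ring epimorphism *)

Lemma subr_exchange (Z : zmodType) (p q r t : Z) : p - q - (r - t) = p - r - (q - t).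
Proof. by rewrite !opprB addrACA [in RHS]addrACA [- r + _]addrC. Qed.

Section EpiTensor.
Variables (R S : pzRingType) (lambda : {rmorphism R -> S}).
Hypothesis lambda_epi : ring_epi lambda.

Let SR_scale (x : S^o) (r : R) : S^o := (x : S) * lambda r.
Let SR_scale1 x : SR_scale x 1 = x.
Proof. by rewrite /SR_scale rmorph1 mulr1. Qed.
Let SR_scaleA x r r' : SR_scale (SR_scale x r) r' = SR_scale x (r * r').
Proof. by rewrite /SR_scale rmorphM mulrA. Qed.
Let SR_scaleDl x y r : SR_scale (x + y) r = SR_scale x r + SR_scale y r.
Proof. exact: mulrDl. Qed.
Let SR_scaleDr x r r' : SR_scale x (r + r') = SR_scale x r + SR_scale x r'.
Proof. by rewrite /SR_scale rmorphD mulrDr. Qed.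
Let SR_scaleAl (a : S) x r : a *: SR_scale x r = SR_scale (a *: x) r.
Proof. exact: mulrA. Qed.

Definition SR_bimod : bimodType S R :=
  Bimodule SR_scale1 SR_scaleA SR_scaleDl SR_scaleDr SR_scaleAl.

Local Notation SS := (btens SR_bimod (restr lambda S^o)).

Definition SS_pure (a b : S) : SS := tens_pure (a : bimod_right SR_bimod) (b : restr lambda S^o).

Lemma SS_rmul_subproof (s : S) :
  linear (fun x : restr lambda S^o => (x : S) * s : restr lambda S^o).
Proof. by move=> r x y; rewrite mulrDl -mulrA. Qed.
Definition SS_rmul (s : S) := mklin (SS_rmul_subproof s).

Definition SS_rscale (t : SS) (s : S) : SS := tens_map (SS_rmul s) t.

Lemma SS_rscale_pure a b s : SS_rscale (SS_pure a b) s = SS_pure a (b * s).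
Proof. exact: tens_map_pure. Qed.
Lemma SS_scale_pure a b s : s *: SS_pure a b = SS_pure (s * a) b.
Proof. exact: btens_scale_pure. Qed.
Lemma SS_rscaleDl t t' s : SS_rscale (t + t') s = SS_rscale t s + SS_rscale t' s.
Proof. exact: tens_mapD. Qed.
Lemma SS_rscale1 t : SS_rscale t 1 = t.
Proof. by apply: tens_map_id => x; exact: mulr1. Qed.
Lemma SS_rscaleA t s s' : SS_rscale (SS_rscale t s) s' = SS_rscale t (s * s').
Proof. by apply: esym; apply: tens_map_comp => x; exact: mulrA. Qed.
Lemma SS_rscaleDr t s s' : SS_rscale t (s + s') = SS_rscale t s + SS_rscale t s'.
Proof. by apply: tens_map_add => x; exact: mulrDr. Qed.
Lemma SS_rscaleAl (s : S) t s' : s *: SS_rscale t s' = SS_rscale (s *: t) s'.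
Proof.
move: t; apply: tens_eq_pure => [t t'|t t'|a b].
- by rewrite -scalerDr; congr (_ *: _); exact: SS_rscaleDl.
- by rewrite -SS_rscaleDl -scalerDr.
- suff E : s *: SS_rscale (SS_pure a b) s' = SS_rscale (s *: SS_pure a b) s' by exact: E.
  by rewrite SS_rscale_pure !SS_scale_pure SS_rscale_pure.
Qed.
Definition SS_bimod : bimodType S S :=
  Bimodule SS_rscale1 SS_rscaleA SS_rscaleDl SS_rscaleDr SS_rscaleAl.

Lemma SS_pureDl a a' b : SS_pure (a + a') b = SS_pure a b + SS_pure a' b.
Proof. exact: tens_pureDl. Qed.
Lemma SS_pureDr a b b' : SS_pure a (b + b') = SS_pure a b + SS_pure a b'.
Proof. exact: tens_pureDr. Qed.
Lemma SS_pureNl a b : SS_pure (- a) b = - SS_pure a b.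
Proof.
have p0 : SS_pure 0 b = 0 by exact: tens_pure0l.
by apply: (addrI (SS_pure a b)); rewrite -SS_pureDl !subrr.
Qed.
Lemma SS_pureNr a b : SS_pure a (- b) = - SS_pure a b.
Proof. exact: tens_pureNr. Qed.
Lemma SS_pure_lambda r : SS_pure (lambda r) 1 = SS_pure 1 (lambda r).
Proof.
have := tens_pureZ (M := bimod_right SR_bimod) (X := restr lambda S^o) r (1 : S) (1 : S).
rewrite /SS_pure.
have -> : (r : R^c) *: ((1 : S) : bimod_right SR_bimod) = lambda r by exact: mul1r.
by have -> : r *: ((1 : S) : restr lambda S^o) = lambda r by exact: mulr1.
Qed.

(** The derivation [s |-> s (x) 1 - 1 (x) s] into [S (x)_R S] kills the image of
    [R], so it yields two homomorphisms from [S] to a trivial extension that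
    agree on [R]. *)
Lemma SS_pure_epi s : SS_pure s 1 = SS_pure 1 s.
Proof.
pose h (s : S) : trivext SS_bimod := (s, SS_pure s 1 - SS_pure 1 s).
have h_zmod : zmod_morphism h.
  move=> a b; rewrite /h SS_pureDl SS_pureDr SS_pureNl SS_pureNr -subr_exchange.
  by [].
have h_monoid : monoid_morphism h.
  split=> [|a b]; first by rewrite /h subrr.
  rewrite /h tmulE; congr pair => /=.
  rewrite SS_rscaleDl scalerDr scalerN.
  have N_r t : SS_rscale (- t) b = - SS_rscale t b.
    have z0 : SS_rscale 0 b = 0.
      by apply: (addrI (SS_rscale 0 b)); rewrite -SS_rscaleDl !addr0.
    by apply: (addrI (SS_rscale t b)); rewrite -SS_rscaleDl !subrr.
  rewrite N_r !SS_rscale_pure !SS_scale_pure mulr1 mul1r.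
  by rewrite addrA subrK.
pose hz := GRing.isZmodMorphism.Build S (trivext SS_bimod) h h_zmod.
pose hm := GRing.isMonoidMorphism.Build S (trivext SS_bimod) h h_monoid.
pose hR : {rmorphism S -> trivext SS_bimod} := HB.pack h hz hm.
pose gR : {rmorphism S -> trivext SS_bimod} := @tin S SS_bimod.
have ghR r : gR (lambda r) = hR (lambda r).
  by congr pair; rewrite /= SS_pure_lambda subrr.
have /(congr1 snd) /= := lambda_epi ghR s.
by move=> /esym/eqP; rewrite subr_eq0 => /eqP.
Qed.

Section Mod.
Variables (M : bimodType S S) (V : lmodType S).
Local Notation MR := (restr_bimod lambda M).

Definition rpure (m : M) (v : V) : tens (bimod_right MR) (restr lambda V) :=
  tens_pure (m : bimod_right MR) (v : restr lambda V).

(** The image of [s (x) 1 = 1 (x) s] under [x (x) y |-> m x (x) y v]. *)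
Lemma rpure_balanced (m : M) (s : S) v : rpure (rscale m s) v = rpure m (s *: v).
Proof.
pose b (x : bimod_right SR_bimod) (y : restr lambda S^o) :=
  rpure (rscale m (x : S)) ((y : S) *: v).
have bDl x x' y : b (x + x') y = b x y + b x' y.
  by rewrite /b rscaleDr; exact: tens_pureDl.
have bDr x y y' : b x (y + y') = b x y + b x y'.
  by rewrite /b scalerDl; exact: tens_pureDr.
have bZ (r : R) x y : b ((r : R^c) *: x) y = b x (r *: y).
  have -> : b ((r : R^c) *: x) y = rpure (rscale (rscale m (x : S)) (lambda r)) ((y : S) *: v).
    by rewrite rscaleA.
  have -> : b x (r *: y) = rpure (rscale m (x : S)) (lambda r *: ((y : S) *: v)).
    by rewrite scalerA.
  exact: (tens_pureZ (M := bimod_right MR) (X := restr lambda V)).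
have bE x y : tens_lift b (SS_pure x y) = b x y by exact: tens_lift_pure.
have := congr1 (tens_lift b) (SS_pure_epi s).
by rewrite !bE /b scale1r rscale1.
Qed.

(** The canonical map from [M (x)_R V] to [M (x)_S V], whose inverse is well
    defined by [rpure_balanced]. *)
Definition tens_RS : tens (bimod_right MR) (restr lambda V) -> tens (bimod_right M) V :=
  tens_lift (fun (m : bimod_right MR) (v : restr lambda V) =>
    tens_pure (m : bimod_right M) (v : V)).
Definition tens_SR : tens (bimod_right M) V -> tens (bimod_right MR) (restr lambda V) :=
  tens_lift (fun (m : bimod_right M) (v : V) => rpure m v).

Lemma tens_RSD s t : tens_RS (s + t) = tens_RS s + tens_RS t.
Proof.
apply: tens_liftD => [m1 m2 x|m1 x y|r m1 x].
- exact: tens_pureDl.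
- exact: tens_pureDr.
- exact: (tens_pureZ (M := bimod_right M) (lambda r) m1 (x : V)).
Qed.
Lemma tens_SRD s t : tens_SR (s + t) = tens_SR s + tens_SR t.
Proof.
apply: tens_liftD => [m1 m2 x|m1 x y|r m1 x].
- exact: tens_pureDl.
- exact: tens_pureDr.
- exact: (rpure_balanced m1 r x).
Qed.
Lemma tens_RS_pure m v : tens_RS (rpure m v) = tens_pure (m : bimod_right M) v.
Proof.
apply: tens_lift_pure => [m1 m2 x|m1 x y|r m1 x].
- exact: tens_pureDl.
- exact: tens_pureDr.
- exact: (tens_pureZ (M := bimod_right M) (lambda r) m1 (x : V)).
Qed.
Lemma tens_SR_pure (m : M) v : tens_SR (tens_pure (m : bimod_right M) v) = rpure m v.
Proof.
apply: tens_lift_pure => [m1 m2 x|m1 x y|r m1 x].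
- exact: tens_pureDl.
- exact: tens_pureDr.
- exact: (rpure_balanced m1 r x).
Qed.
Lemma tens_RSK t : tens_SR (tens_RS t) = t.
Proof.
move: t; apply: tens_eq_pure => [s t|//|m v]; first by rewrite tens_RSD tens_SRD.
by rewrite [tens_pure _ _](_ : _ = rpure m v) // tens_RS_pure tens_SR_pure.
Qed.
Lemma tens_SRK t : tens_RS (tens_SR t) = t.
Proof.
move: t; apply: tens_eq_pure => [s t|//|m v]; first by rewrite tens_SRD tens_RSD.
by rewrite [tens_pure _ _](_ : _ = tens_pure ((m : M) : bimod_right M) v) // tens_SR_pure tens_RS_pure.
Qed.

End Mod.

Lemma tens_SR_map (M : bimodType S S) (V W : lmodType S) (f : {linear V -> W})
    (t : tens (bimod_right M) V) :
  tens_SR (tens_map f t) = tens_map (restr_lin lambda f) (tens_SR t).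
Proof.
move: t; apply: tens_eq_pure => [s t|s t|m v]; first by rewrite tens_mapD tens_SRD.
  by rewrite tens_SRD tens_mapD.
by rewrite tens_map_pure !tens_SR_pure [RHS]tens_map_pure.
Qed.

Lemma exact_tens_restr (M : bimodType S S) (U V W : lmodType S)
    (f : {linear U -> V}) (g : {linear V -> W}) :
  exact_at (tens_map (M := bimod_right (restr_bimod lambda M)) (restr_lin lambda f))
           (tens_map (restr_lin lambda g)) ->
  exact_at (tens_map (M := bimod_right M) f) (tens_map g).
Proof.
move=> ex t; have tens_SR0 X : tens_SR (0 : tens (bimod_right M) X) = 0.
  by apply: (addrI (tens_SR 0)); rewrite addr0 -tens_SRD addr0.
split=> [gt0|[u <-]].
  have [|u uE] := (ex (tens_SR t)).1; first by rewrite -tens_SR_map gt0 tens_SR0.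
  exists (tens_RS u); apply: (can_inj (@tens_SRK _ _)).
  by rewrite tens_SR_map tens_RSK.
apply: (can_inj (@tens_SRK _ _)); rewrite !tens_SR_map tens_SR0; apply/ex.
by exists (tens_SR u).
Qed.

End EpiTensor.

(** * The two inequalities *)

Section Main.
Variables (R S : pzRingType) (lambda : {rmorphism R -> S}) (M : bimodType S S).
Hypothesis lambda_epi : ring_epi lambda.
Hypothesis Tor_M_S : forall i : nat, (1 <= i)%N ->
  Tor_vanishes (bimod_right (restr_bimod lambda M)) (restr lambda S^o) i.
Hypothesis RS_finite : has_finite_fg_proj_resolution (restr lambda S^o).

Local Notation MR := (restr_bimod lambda M).
Local Notation Lam := (trivext M).
Local Notation Gam := (trivext MR).

Lemma tensor_acyclic : derived_vanish (tens_functor (bimod_right MR)) 0 (restr lambda S^o).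
Proof. by move=> P j _; exact: (Tor_M_S (i := j.+1) isT P). Qed.

(** [M (x)_S P] is [M (x)_R P], to which the vanishing of [Tor^R(M, S)] applies. *)
Lemma exact_tens_resolution r n (X : lmodType S) (P : proj_resolution X) :
    (findim R <= Fin r)%enat -> res_length_le P n ->
    (forall j, finitely_generated (P j)) ->
  forall j, (r <= j)%N ->
  exact_at (tens_map (M := bimod_right M) (res_d P j.+1)) (tens_map (res_d P j)).
Proof.
move=> Rr Pn Pfg j rj; have /fgresP[nS fgS] := RS_finite.
apply: (exact_tens_restr lambda_epi).
exact: (exact_above_findim fgS tensor_acyclic Rr Pn Pfg rj).
Qed.

(** [T (x)_S P] is exact above degree [r], hence contractible above degree
    [e + r]; the contraction restricts to the direct summand [P]. *)
Lemma findim_base_le r e : (findim R <= Fin r)%enat -> (findim Lam <= Fin e)%enat ->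
  (findim S <= Fin (r + e))%enat.
Proof.
move=> Rr Le; apply/findim_leP => X /fgresP[n [P [Pn Pfg]]].
have [||||h hE] := @findim_contraction Lam e (fun j => ind M (P (j + r)%N))
  (fun j => ind_map M (res_d P (j + r)%N)) n Le.
- by move=> j; apply/projective_ind/res_projective.
- by move=> j; apply/fg_ind/Pfg.
- move=> j; apply: exact_ind_map; first exact: res_exactS.
  by apply: (exact_tens_resolution Rr Pn Pfg); rewrite leq_addl.
- move=> j nj [x t]; have Pj : forall y : P (j + r)%N, y = 0.
    by apply: Pn; exact: ltn_addr.
  congr pair; first exact: Pj.
  elim/tens_ind: t => [//|s t -> ->|m y]; first by rewrite subrr.
  by rewrite (Pj y) tens_pure0r.
pose D j := ind_map M (res_d P (j + r)%N).
have k_lin : linear (fun x : P (e + r)%N => (h e (ind_unit M _ x)).1 : P (e + r).+1).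
  move=> a x y; rewrite linearP.
  have hZ u v : h e (tin M a *: u + v) = tin M a *: h e u + h e v by rewrite linearP.
  exact: (congr1 fst (hZ (ind_unit M _ x) (ind_unit M _ y))).
rewrite addnC; apply: (pd_le_split (k := mklin k_lin)) => x.
have DD j u : D j (D j.+1 u) = 0.
  case: u => y t; rewrite /D !ind_mapE res_dd; congr pair.
  exact: (@fmap_complex _ (tens_functor (bimod_right M)) _ _ _ (res_d P (j + r).+1) (res_d P (j + r)) (@res_dd _ _ P (j + r)) t).
pose y : ind M (P (e + r).+1) := ind_unit M _ x.
have De : D e y = ind_unit M _ (res_d P (e + r)%N x).
  by rewrite /D [LHS]ind_mapE /btens_map tens_map0.
have := congr1 (D e) (hE e (leqnn e) y).
rewrite linearD [D e (ind_map _ _ _)](DD e (h e.+1 y)) add0r -/(D e y) De => /(congr1 fst) /= E; exact: esym E.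
Qed.

(** ** The trivial extension of [S] as a module over that of [R] *)

Definition trivext_hom (t : Gam) : Lam := (lambda t.1, t.2 : M).
Fact trivext_hom_zmod : zmod_morphism trivext_hom.
Proof. by move=> x y; congr pair; rewrite /= rmorphB. Qed.
Fact trivext_hom_monoid : monoid_morphism trivext_hom.
Proof.
split; first by congr pair; rewrite /= rmorph1.
by move=> x y; congr pair; rewrite /= rmorphM.
Qed.
HB.instance Definition _ := GRing.isZmodMorphism.Build Gam Lam trivext_hom trivext_hom_zmod.
HB.instance Definition _ := GRing.isMonoidMorphism.Build Gam Lam trivext_hom trivext_hom_monoid.

Lemma trivext_hom_teps m : trivext_hom (teps (M := MR) m) = teps (M := M) m.
Proof. by congr pair; rewrite /= rmorph0. Qed.

Lemma eps_span_restr (X : lmodType Lam) (x : X) :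
  eps_span (M := MR) (x : restr trivext_hom X) <-> eps_span x.
Proof.
split; elim=> [|y z _ IHy _ IHz|m y].
- exact: eps_span0.
- exact: eps_spanD.
- have -> : teps (M := MR) m *: y = teps (M := M) m *: (y : X).
    by rewrite -trivext_hom_teps.
  exact: eps_span_gen.
- exact: eps_span0.
- exact: (@eps_spanD _ _ (restr trivext_hom X)).
- have -> : teps (M := M) m *: y = teps (M := MR) m *: (y : restr trivext_hom X).
    by rewrite -trivext_hom_teps.
  exact: (@eps_span_gen _ _ (restr trivext_hom X)).
Qed.

Definition LamGam : lmodType Gam := restr trivext_hom Lam^o.
Definition to_LamGam (x : Lam) : LamGam := x.
Lemma to_LamGamD x y : to_LamGam (x + y) = to_LamGam x + to_LamGam y. Proof. by []. Qed.
Lemma to_LamGamZ t x : t *: to_LamGam x = to_LamGam (trivext_hom t * x). Proof. by []. Qed.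

Definition mul_bal (m : bimod_right MR) (s : restr lambda S^o) : M := @rscale S S M m s.

Lemma mul_balDl m m' s : mul_bal (m + m') s = mul_bal m s + mul_bal m' s.
Proof. exact: rscaleDl. Qed.
Lemma mul_balDr m s s' : mul_bal m (s + s') = mul_bal m s + mul_bal m s'.
Proof. exact: rscaleDr. Qed.
Lemma mul_balZ (r : R) m s : mul_bal ((r : R^c) *: m) s = mul_bal m (r *: s).
Proof. exact: rscaleA. Qed.

Definition mulS : tens (bimod_right MR) (restr lambda S^o) -> M := tens_lift mul_bal.

Lemma mulSD s t : mulS (s + t) = mulS s + mulS t.
Proof. exact: (tens_liftD mul_balDl mul_balDr mul_balZ). Qed.
Lemma mulS_pure m s : mulS (tens_pure m s) = mul_bal m s.
Proof. exact: (tens_lift_pure mul_balDl mul_balDr mul_balZ). Qed.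
Lemma mulS0 : mulS 0 = 0.
Proof. by apply: (addrI (mulS 0)); rewrite -mulSD !addr0. Qed.

Lemma mulS_inj t : mulS t = 0 -> t = 0.
Proof.
have tE : rpure lambda (mulS t) (1 : S^o) = t.
  move: t; apply: tens_eq_pure => [s t|//|m s].
    by rewrite mulSD; exact: tens_pureDl.
  rewrite mulS_pure [LHS](rpure_balanced lambda_epi (m : M) (s : S) (1 : S^o)).
  by congr tens_pure; exact: mulr1.
by move=> t0; rewrite -tE t0; exact: tens_pure0l.
Qed.

Section IndResolution.
Variable F : proj_resolution (restr lambda S^o).

Definition res_unit (x : F 0%N) : restr (tin MR) LamGam := to_LamGam (tin M (res_aug F x : S)).

Lemma res_unit_subproof : linear res_unit.
Proof.
have unitE x : res_unit x = to_LamGam (tin M (res_aug F x : S)) by [].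
apply: linear_of_addZ => [x y|r x]; rewrite !unitE.
  rewrite (linearD (res_aug F)) [tin M _](rmorphD (tin M)); exact: to_LamGamD.
have -> : res_aug F (r *: x) = r *: res_aug F x by rewrite linearZ.
apply: etrans (esym (to_LamGamZ (tin MR r) _)).
rewrite [tin M _](rmorphM (tin M) (lambda r) (res_aug F x : S)).
by congr (to_LamGam (_ * _)); congr pair; rewrite /= rmorph0.
Qed.
Definition res_unit_lin := mklin res_unit_subproof.
Lemma res_unit_linE x : res_unit_lin x = to_LamGam (tin M (res_aug F x : S)) :> LamGam.
Proof. by []. Qed.

Definition ind_aug := @ind_lift R MR (F 0%N) LamGam res_unit_lin.

Lemma ind_aug_pair x t : ind_aug (x, t) = ind_aug (x, 0) + ind_aug (0, t).
Proof.
have -> : (x, t) = (x, 0) + (0, t) :> ind MR (F 0%N).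
  by congr pair; rewrite /= ?addr0 ?add0r.
exact: linearD.
Qed.
Lemma ind_aug_unit x : ind_aug (x, 0) = to_LamGam (tin M (res_aug F x : S)).
Proof. exact: etrans (ind_lift_unit res_unit_lin x) (res_unit_linE x). Qed.

Lemma ind_aug_eps t : ind_aug (0, t) = teps (M := M) (mulS (tens_map (res_aug F) t)) :> Lam.
Proof.
move: t; apply: tens_eq_pure => [s t|s t|m x].
- have -> : (0, s + t) = (0, s) + (0, t) :> ind MR (F 0%N).
    by congr pair; rewrite /= addr0.
  exact: linearD.
- by rewrite tens_mapD mulSD tepsD.
rewrite tens_map_pure mulS_pure.
have -> : ind_aug (0, tens_pure m x) = teps (M := MR) m *: (res_unit x : LamGam).
  apply: etrans (ind_liftE res_unit_lin 0 m x) _.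
  by rewrite linear0; exact: add0r.
have -> : teps (M := MR) m *: (res_unit x : LamGam) = teps (M := M) m * tin M (res_aug F x : S).
  by rewrite -trivext_hom_teps.
exact: teps_tin.
Qed.

Lemma ind_augE x t : ind_aug (x, t)
  = (res_aug F x : S, mulS (tens_map (res_aug F) t)) :> Lam.
Proof.
rewrite ind_aug_pair ind_aug_unit ind_aug_eps.
exact: esym (tpairE ((res_aug F x : S, mulS (tens_map (res_aug F) t)) : Lam)).
Qed.

Lemma ind_aug_surj : surj ind_aug.
Proof.
move=> [s m]; have [x xE] := res_aug_surj F (s : S^o).
have [y yE] := res_aug_surj F (1 : S^o).
exists (x, tens_pure (m : bimod_right MR) y).
rewrite ind_augE xE tens_map_pure mulS_pure yE.
by congr pair; exact: rscale1.
Qed.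

Lemma ind_aug_exact : exact_at (ind_map MR (res_d F 0)) ind_aug.
Proof.
have [exF _] := tens_map_rex (bimod_right MR) (res_exact0 F) (res_aug_surj F).
move=> [x t]; split=> [|[[y u]]].
  rewrite ind_augE => -[/(res_exact0 F)[y yE] /mulS_inj/exF[u uE]].
  by exists (y, u); rewrite ind_mapE yE /btens_map uE.
rewrite ind_mapE => -[<- <-]; rewrite ind_augE res_aug_d.
have -> : tens_map (res_aug F) (btens_map (res_d F 0) u) = 0 by apply/exF; exists u.
by rewrite mulS0.
Qed.

Lemma ind_res_exactS j : exact_at (ind_map MR (res_d F j.+1)) (ind_map MR (res_d F j)).
Proof. by apply: exact_ind_map; [exact: res_exactS|exact: tensor_acyclic]. Qed.

(** The components of [ind] separate the exactness: on the first one it is that of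
    [F], on the second one it is the vanishing of [Tor^R(M, S)], together with
    [M (x)_R S = M] at the augmentation. *)
Definition ind_res : proj_resolution LamGam :=
  @ProjResolution Gam LamGam (fun j => ind MR (F j)) (fun j => ind_map MR (res_d F j)) ind_aug
    (fun j => @projective_ind R MR _ (res_projective F j)) ind_aug_surj ind_aug_exact
    ind_res_exactS.

Lemma eps_span_indE (X : lmodType R) (x : X) (t : btens MR X) :
  eps_span ((x, t) : ind MR X) <-> x = 0.
Proof.
split=> [|->].
  move=> xt; suff : forall u : ind MR X, eps_span u -> u.1 = 0 by move/(_ _ xt).
  move=> u; elim=> [//|y z _ IHy _ IHz|m y]; first by rewrite /= IHy IHz addr0.
  exact: scale0r.
elim/tens_ind: t => [|s t sM tM|m y]; first exact: eps_span0.
  have -> : (0, s - t) = (0, s) - (0, t) :> ind MR X by congr pair; rewrite /= subr0.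
  exact: (submodB (W := eps_submod _)).
have -> : (0, tens_pure m y) = teps (M := MR) m *: ((y, 0) : ind MR X).
  by rewrite ind_eps.
exact: eps_span_gen.
Qed.

(** Reduction modulo [M] turns [ind_res] back into [F]. *)
Lemma ind_res_red_exact : exact_above (red_functor MR) 0 ind_res.
Proof.
move=> j _; apply/red_map_exactP => [u|[x t]]; first exact: (res_dd (P := ind_res)).
rewrite [res_d _ _ _](ind_mapE (res_d F j) x t) eps_span_indE => dx.
have [y yE] := (res_exactS F j x).1 dx.
exists ((y, 0) : ind MR (F j.+2)).
have -> : (x, t) - res_d ind_res j.+1 ((y, 0) : ind MR (F j.+2))
    = (x - res_d F j.+1 y, t - btens_map (res_d F j.+1) 0) :> ind MR (F j.+1) by [].
by apply/eps_span_indE; rewrite yE subrr.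
Qed.

End IndResolution.

Lemma LamGam_fgres : exists n, fgres_le n LamGam.
Proof.
have /fgresP[n [F [Fn Ffg]]] := RS_finite; exists n, (ind_res F); split=> [j nj [x t]|j].
  have Fj : forall y : F j, y = 0 by exact: Fn.
  congr pair; first exact: Fj.
  elim/tens_ind: t => [//|s t -> ->|m y]; first by rewrite subrr.
  by rewrite (Fj y) tens_pure0r.
exact/fg_ind/Ffg.
Qed.

Lemma LamGam_acyclic : derived_vanish (red_functor MR) 0 LamGam.
Proof.
have [F _] := RS_finite; apply: (@derived_vanish_of_res _ _ _ _ _ (ind_res F)).
  by exists (lin_id _), (lin_id _).
exact: ind_res_red_exact.
Qed.

(** [P / M P] is the same over both trivial extensions, since both have the same
    square-zero ideal. *)
Lemma exact_red_resolution t n (X : lmodType Lam) (P : proj_resolution X) :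
    (findim Gam <= Fin t)%enat -> res_length_le P n ->
    (forall j, finitely_generated (P j)) ->
  forall j, (t <= j)%N -> exact_at (red_map (res_d P j.+1)) (red_map (res_d P j)).
Proof.
move=> Gt Pn Pfg j tj; have [m fgL] := LamGam_fgres.
have exG := exact_above_findim fgL LamGam_acyclic Gt Pn Pfg tj.
apply/red_map_exactP => [x|y]; first exact: res_dd.
have cyc := (red_map_exactP (f := restr_lin trivext_hom (res_d P j.+1))
  (g := restr_lin trivext_hom (res_d P j)) (@res_dd _ _ P j)).1 exG.
move=> /eps_span_restr /cyc[x xE]; exists x; exact/eps_span_restr.
Qed.

(** [P / M P] is exact above degree [t], hence contractible above degree [s + t]
    over [S]; the contraction lifts to [P]. *)
Lemma findim_trivext_le s t : (findim S <= Fin s)%enat -> (findim Gam <= Fin t)%enat ->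
  (findim Lam <= Fin (s + t))%enat.
Proof.
move=> Ss Gt; apply/findim_leP => X /fgresP[n [P [Pn Pfg]]].
have [||||h hE] := @findim_contraction S s (fun j => red (P (j + t)%N))
  (fun j => red_lin (res_d P (j + t)%N)) n Ss.
- by move=> j; apply/projective_red/res_projective.
- by move=> j; apply/fg_red/Pfg.
- by move=> j; apply: (exact_red_resolution Gt Pn Pfg); rewrite leq_addl.
- move=> j nj; apply: red_ind => x.
  by rewrite (Pn _ _ x) ?linear0 //; exact: ltn_addr.
have [||||k kE] := @lift_contraction S M (P (s + t)%N) (P (s + t).+1) (P (s + t).+2)
  (res_d P (s + t)%N) (res_d P (s + t).+1) (h s) (h s.+1).
- exact: res_projective.
- exact: res_projective.
- exact: res_dd.
- exact: hE (leqnn s).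
exact: pd_le_split kE.
Qed.

End Main.

Theorem corollary1p4 (R S : pzRingType) (lambda : {rmorphism R -> S})
    (M : bimodType S S)
    (lambda_epi : ring_epi lambda)
    (Tor_M_S : forall i : nat, (1 <= i)%N ->
       Tor_vanishes (bimod_right (restr_bimod lambda M)) (restr lambda S^o) i)
    (RS_finite : has_finite_fg_proj_resolution (restr lambda S^o)) :
  (findim (trivext M)
     <= findim S + findim (trivext (restr_bimod lambda M)) + Fin 1)%enat
  /\
  (findim S <= findim R + findim (trivext M))%enat.
Proof.
split.
  case sE: (findim S) => [s|]; last by case: (findim (trivext M)).
  case tE: (findim (trivext (restr_bimod lambda M))) => [t|]; last by case: (findim (trivext M)).
  have := findim_trivext_le lambda_epi Tor_M_S RS_finite (s := s) (t := t).
  rewrite sE tE /= !leqnn => /(_ isT isT); case: (findim (trivext M)) => //= m mst.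
  by apply: leq_trans mst _; rewrite leq_addr.
case rE: (findim R) => [r|]; last by case: (findim S).
case eE: (findim (trivext M)) => [e|]; last by case: (findim S).
by apply: (findim_base_le lambda_epi Tor_M_S RS_finite); rewrite ?rE ?eE /=.
Qed.
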